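(* For positive integers $a,b,c$ with $a\le b$, let $$f^{a,b}_c(x,y,z,w)=ax^2+by^2+c(z^2+zw+w^2),\qquad x,y,z,w\in\mathbb{Z}.$$ (1) $f^{a,b}_c$ represents every nonnegative integer if and only if $(a,b,c)$ is one of: $(1,b,1)$ with $b\in\{1,2,3,4,5,6\}$; $(2,b,1)$ with $b\in\{2,3,4,5,6,7,8,9,10\}$; $(1,b,2)$ with $b\in\{1,2,3,4,5\}$; $(1,2,3)$; $(1,2,4)$. (2) If $f^{a,b}_c$ represents each of $n=1,2,3,5,6,10$, then it represents every nonnegative integer.
   Context: A form $f$ ''represents'' an integer $n$ if $n=f(x,y,z,w)$ for some integers $x,y,z,w$. *)

(* Defs.v *)
From Stdlib Require Import ZArith List.
Open Scope Z_scope.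

Definition f_abc (a b c x y z w : Z) : Z :=
  a * x ^ 2 + b * y ^ 2 + c * (z ^ 2 + z * w + w ^ 2).

Definition represents (a b c n : Z) : Prop :=
  exists x y z w : Z, n = f_abc a b c x y z w.

Definition universal (a b c : Z) : Prop :=
  forall n : Z, 0 <= n -> represents a b c n.

Definition universal_triple (a b c : Z) : Prop :=
  (a = 1 /\ c = 1 /\ 1 <= b <= 6) \/
  (a = 2 /\ c = 1 /\ 2 <= b <= 10) \/
  (a = 1 /\ c = 2 /\ 1 <= b <= 5) \/
  (a = 1 /\ b = 2 /\ c = 3) \/
  (a = 1 /\ b = 2 /\ c = 4).

(* Main.v *)
Require Import Defs.
From Stdlib Require Import ZArith List Lia Classical Reals.
From mathcomp Require Import all_boot all_order all_algebra all_fingroup all_solvable all_field.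
From mathcomp Require Import ring lra zify.
From mathcomp Require Import Rstruct.

(* Write N(z,w) = z^2 + zw + w^2 ([eis] below). The values 1, 2, 3, 5, 6, 10 leave only the
   listed triples. For those, a suitable choice of one variable reduces each form to one of the ternary forms x^2 + N, 2x^2 + N,
   x^2 + 2N at a number m in convenient residue classes. To represent m by such a ternary form, take a
   prime p = 1 mod 3, so that p is a value of N, in such a class modulo m that Legendre's conditions hold
   for a x^2 + p y^2 = m z^2 (or with 2p for p); the quadratic reciprocity law controls whether m is a
   square modulo p. A solution represents m rationally, and the Aubry-Davenport-Cassels descent makes
   the representation integral. Only the class of p modulo squares matters, so Dirichlet's theorem is needed
   just for cosets of the subgroup of squares, where all characters are real. *)

Set Implicit Arguments. Unset Strict Implicit. Unset Printing Implicit Defensive.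
Import Order.TTheory GRing.Theory Num.Theory.
Local Open Scope ring_scope.

(** * Real characters and primes in cosets of the squares *)

(** The auxiliary prime p is always taken 3 mod 4, for three reasons. Its class is then a non-square
    modulo 4, as the analytic argument requires, since it produces primes only in cosets other than
    that of 1. The Gauss sum has square -p, so reciprocity reads (q/p) = (-p/q) with no sign to
    track, and -p is what the condition modulo m controls. Finally, a residue m has the explicit
    root m^((p+1)/4).

    Knowing p only up to a square factor loses nothing: squares of units are 1 modulo 24, so
    prescribed classes modulo 3 and 8 survive, and modulo m one only needs -p, or -p/2, to be a
    square.

    Restricting to real characters removes the usual difficulty of L(1, chi) <> 0, since the divisor
    sums of a real character are nonnegative; finite sums with explicit constants then suffice.

    The descent is proved for a x^2 + N with a <= 2 only. The form x^2 + 2N is reached by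
    representing 2m by 2x^2 + N and halving, as N is even only at even arguments. *)

Lemma abel_bound (R : realFieldType) (u c : nat -> R) (a b : nat) (M : R) :
    (forall k, (a <= k)%N -> 0 <= u k) ->
    (forall k, (a <= k)%N -> u k.+1 <= u k) ->
    (forall k, `|\sum_(a <= i < k) c i| <= M) ->
  `|\sum_(a <= i < b) c i * u i| <= M * u a.
Proof.
move=> u0 udec cM; have M0 : 0 <= M by apply: le_trans (cM 0%N); rewrite normr_ge0.
have [ba|ab] := leqP b a; first by rewrite big_geq // normr0 mulr_ge0 // u0.
suff: forall b', (a <= b')%N -> `|\sum_(a <= i < b') c i * u i - (\sum_(a <= i < b') c i) * u b'|
    <= M * (u a - u b').
  move=> /(_ b (ltnW ab)); have := cM b; have := u0 _ (ltnW ab).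
  set S := \sum_(a <= i < b) c i; set T := \sum_(a <= i < b) _ => ub SM TM.
  have : `|S * u b| <= M * u b by rewrite normrM (ger0_norm ub) ler_wpM2r.
  move: TM; rewrite !ler_norml => /andP[h1 h2] /andP[h3 h4]; apply/andP; split; lra.
elim=> [|k IH]; first by rewrite leqn0 => /eqP ->; rewrite !big_geq // mul0r subr0 normr0 subrr mulr0.
rewrite leq_eqVlt => /orP[/eqP <-|]; first by rewrite !big_geq // mul0r subr0 normr0 subrr mulr0.
rewrite ltnS => ak; have {IH} := IH ak; rewrite !big_nat_recr //=.
set S := \sum_(a <= i < k) c i; set T := \sum_(a <= i < k) _ => IH.
have := cM k.+1; rewrite big_nat_recr //= -/S => SM.
have -> : T + c k * u k - (S + c k) * u k.+1 = (T - S * u k) + (S + c k) * (u k - u k.+1) by ring.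
have -> : M * (u a - u k.+1) = M * (u a - u k) + M * (u k - u k.+1) by ring.
apply: le_trans (ler_normD _ _) (lerD IH _).
by rewrite normrM [X in _ * X]ger0_norm ?subr_ge0 ?udec // ler_wpM2r // subr_ge0 udec.
Qed.

Lemma sum_multiples (R : nmodType) (N d : nat) (h : nat -> R) : (0 < d)%N ->
  \sum_(1 <= n < N.+1 | (d %| n)%N) h n = \sum_(1 <= m < (N %/ d).+1) h (d * m)%N.
Proof.
move=> d0; elim: N => [|N IH]; first by rewrite div0n !big_geq.
rewrite big_mkcond big_nat_recr //= -big_mkcond IH divnS //.
case: ifP => [dN|_]; last by rewrite addr0.
rewrite add1n [RHS]big_nat_recr //=; congr (_ + h _).
by rewrite -[LHS](divnK dN) mulnC divnS // dN.
Qed.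

Lemma sum_divisors (R : nmodType) (N : nat) (h : nat -> nat -> R) :
  \sum_(1 <= n < N.+1) \sum_(1 <= d < N.+1 | (d %| n)%N) h d n =
  \sum_(1 <= d < N.+1) \sum_(1 <= m < (N %/ d).+1) h d (d * m)%N.
Proof.
under eq_bigr do rewrite big_mkcond.
rewrite exchange_big /=; apply: eq_big_nat => d /andP[d0 _].
by rewrite -big_mkcond sum_multiples.
Qed.

Lemma sum_divisorsE (R : nmodType) (N n : nat) (h : nat -> R) : (0 < n <= N)%N ->
  \sum_(1 <= d < N.+1 | (d %| n)%N) h d = \sum_(d <- divisors n) h d.
Proof.
move=> /andP[n0 nN]; rewrite -big_filter; apply: perm_big; apply: uniq_perm.
- by rewrite filter_uniq // iota_uniq.
- exact: divisors_uniq.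
move=> d; rewrite mem_filter mem_index_iota -dvdn_divisors // andbC.
have [dn|] := boolP (d %| n)%N; rewrite ?andbF // andbT.
by rewrite (dvdn_gt0 n0 dn) ltnS (leq_trans (dvdn_leq n0 dn)).
Qed.

(** Splitting divisors by whether p divides them gives a recursion in the exponent k, used both for
    divisor sums of a character and for those of the von Mangoldt function. *)
Lemma perm_divisors_pfactor (p k m : nat) : prime p -> ~~ (p %| m)%N -> (0 < m)%N ->
  perm_eq (divisors (p ^ k.+1 * m)) (divisors m ++ [seq (p * d)%N | d <- divisors (p ^ k * m)]).
Proof.
move=> pp pm m0; have p0 := prime_gt0 pp.
have n0 j : (0 < p ^ j * m)%N by rewrite muln_gt0 expn_gt0 p0.
apply: uniq_perm; first exact: divisors_uniq.
  rewrite cat_uniq divisors_uniq map_inj_uniq ?divisors_uniq /=; last first.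
    by move=> x y /eqP; rewrite eqn_pmul2l // => /eqP.
  rewrite andbT; apply/hasPn => _ /mapP[e _ ->]; rewrite -dvdn_divisors //.
  by apply: contra pm => /(dvdn_trans (dvdn_mulr e (dvdnn p))).
move=> d; rewrite mem_cat -!dvdn_divisors //.
have [/dvdnP[e ->]|pd] := boolP (p %| d)%N.
  rewrite mulnC expnS -mulnA dvdn_pmul2l //.
  have -> : (p * e %| m)%N = false.
    by apply: contraNF pm => /(dvdn_trans (dvdn_mulr e (dvdnn p))).
  by rewrite mem_map -?dvdn_divisors // => x y /eqP; rewrite eqn_pmul2l // => /eqP.
rewrite Gauss_dvdr; last by rewrite coprime_sym coprimeXl // prime_coprime.
case: (d %| m)%N => //=; symmetry; apply/negbTE/mapP => -[e _ de].
by move: pd; rewrite de dvdn_mulr.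
Qed.

(** * A positive lower bound for the partial sums of L(1, chi), chi real *)

Section RealCharacter.
Variables (R : realFieldType) (chi : nat -> R) (M : nat).
Hypothesis chiM : {morph chi : a b / (a * b)%N >-> a * b}.
Hypothesis chi1 : chi 1%N = 1.
Hypothesis chi_val : forall n, [\/ chi n = 0, chi n = 1 | chi n = -1].
Hypothesis chi_sum : forall a b, `|\sum_(a <= i < b) chi i| <= M%:R.

Let F n := \sum_(d <- divisors n) chi d.

(** By the recursion [rec], [F (p ^ k * m)] is [F m], (k+1) [F m], or alternately [F m] and 0,
    according as [chi p] is 0, 1 or -1. Even exponents therefore never decrease the sum, which is
    what squares need. *)
Lemma char_divisor_sum_pfactor p k m : prime p -> ~~ (p %| m)%N -> (0 < m)%N ->
  0 <= F m -> 0 <= F (p ^ k * m) /\ (~~ odd k -> F m <= F (p ^ k * m)).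
Proof.
move=> pp pm m0 Fm.
have rec j : F (p ^ j.+1 * m) = F m + chi p * F (p ^ j * m).
  rewrite /F (perm_big _ (perm_divisors_pfactor j pp pm m0)) big_cat big_map /=.
  by under [X in _ + X]eq_bigr do rewrite chiM; rewrite -mulr_sumr.
have [c0|c1|cN] := chi_val p.
- by case: k => [|k]; rewrite ?mul1n // rec c0 mul0r addr0.
- have h j : F m <= F (p ^ j * m).
    elim: j => [|j IH]; first by rewrite mul1n.
    by rewrite rec c1 mul1r lerDl (le_trans Fm).
  by split=> //; apply: le_trans Fm _.
have h j : F (p ^ j * m) = if odd j then 0 else F m.
  elim: j => [|j IH]; first by rewrite mul1n.
  by rewrite rec IH cN mulN1r /=; case: (odd j); rewrite ?subr0 ?subrr.
by rewrite h; case: (odd k).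
Qed.

Lemma char_divisor_sum_ge0 n : (0 < n)%N -> 0 <= F n.
Proof.
elim/ltn_ind: n => n IH n0; have [n1|n1] := leqP n 1.
  have -> : n = 1%N by lia.
  by rewrite /F /divisors /= big_seq1 chi1.
have pp := pdiv_prime n1; set p := pdiv n in pp.
have [m pm nE] := pfactor_coprime pp n0.
rewrite prime_coprime // in pm.
have m0 : (0 < m)%N by case: m nE {pm} => // nE; rewrite nE mul0n in n0.
have k0 : (0 < logn p n)%N by rewrite logn_gt0 mem_primes pp n0 pdiv_dvd.
rewrite nE mulnC; apply: (char_divisor_sum_pfactor _ _ _ _ _).1 => //.
apply: IH => //; rewrite [X in (_ < X)%N]nE -[X in (X < _)%N]muln1 ltn_pmul2l //.
by rewrite -(expn0 p) ltn_exp2l // prime_gt1.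
Qed.

Lemma char_divisor_sum_sqr t : (0 < t)%N -> 1 <= F (t ^ 2).
Proof.
elim/ltn_ind: t => n IH n0; have [n1|n1] := leqP n 1.
  have -> : n = 1%N by lia.
  by rewrite /F /divisors /= big_seq1 chi1.
have pp := pdiv_prime n1; set p := pdiv n in pp.
have [m pm nE] := pfactor_coprime pp n0.
rewrite prime_coprime // in pm.
have m0 : (0 < m)%N by case: m nE {pm} => // nE; rewrite nE mul0n in n0.
have k0 : (0 < logn p n)%N by rewrite logn_gt0 mem_primes pp n0 pdiv_dvd.
have mn : (m < n)%N.
  rewrite [X in (_ < X)%N]nE -[X in (X < _)%N]muln1 ltn_pmul2l //.
  by rewrite -(expn0 p) ltn_exp2l // prime_gt1.
rewrite nE expnMn -expnM mulnC; apply: le_trans (IH m mn m0) _.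
apply: (char_divisor_sum_pfactor _ _ _ _ _).2 => //; rewrite ?expn_gt0 ?m0 //.
- by rewrite Euclid_dvdX // negb_and pm.
- by rewrite char_divisor_sum_ge0 // expn_gt0 m0.
by rewrite oddM andbF.
Qed.

(* Partial sums of [L(1, chi)]; working with them avoids taking the limit. *)
Definition charA n := \sum_(1 <= d < n.+1) chi d / d%:R.

Lemma charA_tail a b : (0 < a)%N -> `|\sum_(a <= d < b) chi d / d%:R| <= M%:R / a%:R.
Proof.
move=> a0; apply: (@abel_bound R (fun k => k%:R^-1)) => [k _|k ak|k].
- by rewrite invr_ge0 ler0n.
- have k0 : (0 < k)%N by apply: leq_trans ak.
  by rewrite lef_pV2 ?posrE ?ltr0n // ler_nat.
exact: chi_sum.
Qed.

Lemma charA_dist a b : (a <= b)%N -> `|charA b - charA a| <= M%:R / a.+1%:R.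
Proof.
move=> ab; rewrite /charA (@big_cat_nat _ _ _ a.+1) //= addrAC subrr add0r.
exact: charA_tail.
Qed.

Let G (N d : nat) : R := \sum_(1 <= m < (N %/ d).+1) (N - d * m)%N%:R.

(** With r = N mod d the error is exactly r(d-r)/(2d). The second-order term -N/2 does not depend on
    d, so against [chi] it costs only N/2 times a bounded character sum; this is the gain of the
    weights N - n over plain counting. *)
Lemma cesaro_weightE N d : (0 < d)%N ->
  exists2 e : R, 0 <= e <= d%:R & G N d = N%:R ^+ 2 / (2 * d%:R) - N%:R / 2 + e /\ G N d <= N%:R ^+ 2 / (2 * d%:R).
Proof.
move=> d0; set k := (N %/ d)%N; set r := (N %% d)%N.
have NE : N = (k * d + r)%N := divn_eq N d.
have rd : (r < d)%N by rewrite ltn_pmod.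
have dR : 0 < d%:R :> R by rewrite ltr0n.
have sumE j : (j <= k)%N ->
    2 * \sum_(1 <= m < j.+1) (N - d * m)%N%:R = 2 * j%:R * N%:R - d%:R * j%:R * (j%:R + 1) :> R.
  elim: j => [|j IH] jk; first by rewrite big_geq //; ring.
  rewrite big_nat_recr //= mulrDr IH 1?ltnW // natrB; last first.
    by rewrite NE mulnC (leq_trans _ (leq_addr _ _)) // leq_mul2r jk orbT.
  by rewrite natrM -natr1; ring.
have GE := sumE k (leqnn k); rewrite -/(G N d) in GE.
have NR : N%:R = k%:R * d%:R + r%:R :> R by rewrite -natrM -natrD -NE.
have rR : 0 <= r%:R :> R by rewrite ler0n.
have drR : r%:R <= d%:R :> R by rewrite ler_nat ltnW.
have rN : r%:R <= N%:R :> R by rewrite ler_nat leq_mod.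
have d2 : 0 < 2 * d%:R :> R by rewrite mulr_gt0.
exists (r%:R * (d%:R - r%:R) / (2 * d%:R)).
  apply/andP; split; first by rewrite divr_ge0 ?mulr_ge0 ?subr_ge0 // ltW.
  by rewrite ler_pdivrMr //; nra.
have -> : G N d = (2 * k%:R * N%:R - d%:R * k%:R * (k%:R + 1)) / 2 by rewrite -GE; field.
split; first by rewrite NR; field; rewrite gt_eqF.
rewrite ler_pdivlMr // mulrAC ler_pdivrMr // NR.
rewrite NR in rN. nra.
Qed.

Lemma cesaro_weight_tail N D b :
  `|\sum_(D.+1 <= d < b) chi d * G N d| <= M%:R * G N D.+1.
Proof.
(* Truncated subtraction kills the terms beyond N/d, so all these sums share one range and their
   monotonicity in d is termwise. *)
have GE d : (0 < d)%N -> G N d = \sum_(1 <= m < N.+1) (N - d * m)%N%:R.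
  move=> d0; rewrite [RHS](@big_cat_nat _ _ _ (N %/ d).+1) //=; last by rewrite ltnS leq_div.
  rewrite [X in _ + X]big_nat [X in _ + X]big1 ?addr0 // => m /andP[m1 _].
  suff -> : (N - d * m = 0)%N by [].
  apply/eqP; rewrite subn_eq0 (leq_trans (ltnW (ltn_ceil N d0))) // mulnC.
  by rewrite leq_mul2l m1 orbT.
apply: abel_bound => [k _|k ak|k]; last exact: chi_sum.
  by rewrite sumr_ge0.
rewrite !GE //; last by apply: leq_trans ak.
by apply: ler_sum => m _; rewrite ler_nat leq_sub2l // leq_mul2r leqnSn orbT.
Qed.

Lemma square_indicator_sum (T n : nat) : (0 < n)%N ->
  \sum_(t < T) (t.+1 ^ 2 == n)%N%:R <= F n.
Proof.
move=> n0; case: (pickP (fun t : 'I_T => t.+1 ^ 2 == n)%N) => [t /eqP <-|no]; last first.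
  by rewrite big1 ?char_divisor_sum_ge0 // => t _; rewrite no.
rewrite (bigD1 t) //= eqxx big1 ?addr0 ?char_divisor_sum_sqr // => i it.
by rewrite eqn_exp2r // eqSS (inj_eq val_inj) (negbTE it).
Qed.

(** Exchanging summations gives the sum of (N - n) [F n] with N = 4T^2. Each of the T squares up to
    T^2 contributes at least its weight, which is at least 3T^2. *)
Lemma cesaro_lower (T : nat) :
  3 * T%:R ^+ 3 <= \sum_(1 <= d < (4 * T ^ 2).+1) chi d * G (4 * T ^ 2) d.
Proof.
set N := (4 * T ^ 2)%N.
have -> : \sum_(1 <= d < N.+1) chi d * G N d = \sum_(1 <= n < N.+1) (N - n)%N%:R * F n.
  under eq_bigr do rewrite mulr_sumr.
  rewrite -(sum_divisors N (fun d n => chi d * (N - n)%N%:R)).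
  apply: eq_big_nat => n nN; rewrite sum_divisorsE // mulr_sumr.
  by apply: eq_bigr => d _; rewrite mulrC.
have step : \sum_(1 <= n < N.+1) (N - n)%N%:R * (\sum_(t < T) (t.+1 ^ 2 == n)%N%:R) <=
    \sum_(1 <= n < N.+1) (N - n)%N%:R * F n.
  rewrite big_nat [X in _ <= X]big_nat; apply: ler_sum => n /andP[n0 _].
  by rewrite ler_wpM2l // square_indicator_sum.
apply: le_trans step.
under eq_bigr do rewrite mulr_sumr.
rewrite exchange_big /=.
have -> : 3 * T%:R ^+ 3 = \sum_(t < T) (3 * T ^ 2)%N%:R :> R.
  by rewrite sumr_const card_ord -mulr_natr natrM natrX; ring.
apply: ler_sum => t _.
have tT : (t.+1 ^ 2 <= T ^ 2)%N by rewrite leq_exp2r.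
rewrite (bigD1_seq (t.+1 ^ 2)%N) ?iota_uniq //=; last first.
  by rewrite mem_index_iota expn_gt0 /N; lia.
rewrite eqxx mulr1 big1 ?addr0 => [|n /negbTE nt]; last by rewrite eq_sym nt mulr0.
by rewrite ler_nat /N; lia.
Qed.

Hypothesis M_gt0 : (0 < M)%N.

(* The divisor sums [F n] are nonnegative and at least 1 on squares, so their sum with the Cesaro
   weights [N - n] is at least of order [N^(3/2)]; it is also [N^2/2 * L(1, chi)] up to [O(N)] and a tail
   [O(N^2/D)], which is small against [N^(3/2)] when [D] is a large multiple of [sqrt N]. *)
Lemma charA_lower : exists2 c : R, 0 < c & exists D, forall n, (D <= n)%N -> c <= charA n.
Proof.
(* [D] makes the tail at most M N^2/(2D) = T^3/2. After division by T^2 the other errors are 2M +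
   256M^2 = 2(T-1), so 3T <= 8T^2 [charA D] + 2(T-1) + T/2, whence [charA D] > 1/(16T) = M/D. That
   is the amount by which [charA] can still move beyond [D]. *)
pose T := (M + 128 * M ^ 2 + 1)%N; pose N := (4 * T ^ 2)%N; pose D := (16 * M * T)%N.
have DN : (D <= N)%N by rewrite /D /N /T; nia.
have T0 : 0 < T%:R :> R by rewrite ltr0n /T addn1.
have M0 : 0 < M%:R :> R by rewrite ltr0n.
have DE : D%:R = 16 * M%:R * T%:R :> R by rewrite /D !natrM.
have D0 : 0 < D%:R :> R by rewrite DE !mulr_gt0.
have NE : N%:R = 4 * T%:R ^+ 2 :> R by rewrite /N natrM natrX.
have TE : T%:R = M%:R + 128 * M%:R ^+ 2 + 1 :> R by rewrite /T !(natrD, natrM, natrX).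
have lower := cesaro_lower T; rewrite -/N in lower.
rewrite (@big_cat_nat _ _ _ D.+1) //= in lower.
have tail := cesaro_weight_tail N D N.+1.
have [_ _ [_ GD]] := @cesaro_weightE N D.+1 isT.
have GD' : G N D.+1 <= N%:R ^+ 2 / (2 * D%:R).
  apply: le_trans GD _; rewrite ler_wpM2l ?sqr_ge0 // lef_pV2 ?posrE ?mulr_gt0 //.
  by rewrite ler_pM2l // ler_nat.
have head : \sum_(1 <= d < D.+1) chi d * G N d <=
    N%:R ^+ 2 / 2 * charA D + N%:R / 2 * M%:R + D%:R ^+ 2.
  have : \sum_(1 <= d < D.+1) chi d * G N d <= \sum_(1 <= d < D.+1)
     (N%:R ^+ 2 / 2 * (chi d / d%:R) - N%:R / 2 * chi d + D%:R).
    rewrite big_nat [X in _ <= X]big_nat; apply: ler_sum => d /andP[d0 dD].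
    have [e /andP[e0 ed] [-> _]] := cesaro_weightE N d0.
    have dR : d%:R <= D%:R :> R by rewrite ler_nat.
    have d0R : d%:R != 0 :> R by rewrite pnatr_eq0 -lt0n.
    have -> : chi d * (N%:R ^+ 2 / (2 * d%:R) - N%:R / 2 + e) =
      N%:R ^+ 2 / 2 * (chi d / d%:R) - N%:R / 2 * chi d + chi d * e by field.
    by rewrite lerD2l; case: (chi_val d) => ->; lra.
  move/le_trans; apply; rewrite big_split /= sumrB -!mulr_sumr sumr_const_nat subn1 /=.
  have -> : D%:R *+ D = D%:R ^+ 2 :> R by rewrite -[LHS]mulr_natr expr2.
  rewrite lerD2r lerD2l -mulrN ler_wpM2l ?divr_ge0 //.
  by have := chi_sum 1 D.+1; rewrite ler_norml => /andP[]; lra.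
exists (charA D - M%:R / D%:R); last first.
  exists D => n Dn; have := charA_dist Dn; rewrite ler_norml => /andP[h _].
  suff : M%:R / D.+1%:R <= M%:R / D%:R :> R.
    by move: (M%:R / D.+1%:R) (M%:R / D%:R) h => x y; lra.
  by rewrite ler_pM2l // lef_pV2 ?posrE // ler_nat.
rewrite subr_gt0 DE.
have -> : M%:R / (16 * M%:R * T%:R) = (16 * T%:R)^-1 :> R.
  by field; rewrite ?gt_eqF.
have tail' : \sum_(D.+1 <= d < N.+1) chi d * G N d <= T%:R ^+ 3 / 2.
  move: tail; rewrite ler_norml => /andP[_ /le_trans]; apply.
  apply: le_trans (ler_wpM2l (ltW M0) GD') _.
  rewrite NE DE le_eqVlt; apply/orP; left; apply/eqP; field.
  by rewrite ?gt_eqF.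
rewrite -div1r ltr_pdivrMr ?mulr_gt0 //.
have H : 3 * T%:R ^+ 3 <= N%:R ^+ 2 / 2 * charA D + N%:R / 2 * M%:R + D%:R ^+ 2 + T%:R ^+ 3 / 2.
  by apply: le_trans lower _; rewrite lerD.
rewrite NE DE in H.
have H2 : 3 * T%:R <= 8 * T%:R ^+2 * charA D + 2 * M%:R + 256 * M%:R ^+ 2 + T%:R / 2.
  rewrite -(ler_pM2r (exprn_gt0 2 T0)); apply: le_trans (le_trans H _); first by rewrite le_eqVlt; apply/orP; left; apply/eqP; ring.
  by rewrite le_eqVlt; apply/orP; left; apply/eqP; field.
rewrite -(ltr_pM2l T0); nra.
Qed.

End RealCharacter.

(** * The von Mangoldt function, Chebyshev's bound, and its sums against a real character *)

Section Mangoldt.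
Variables (R : realFieldType) (lg : nat -> R).
Hypothesis lgM : forall a b, (0 < a)%N -> (0 < b)%N -> lg (a * b)%N = lg a + lg b.

Let lg1 : lg 1 = 0.
Proof. by have := @lgM 1 1 isT isT; rewrite muln1; lra. Qed.

Hypothesis lg_mono : forall a b, (0 < a)%N -> (a <= b)%N -> lg a <= lg b.

Let lg_ge0 n : (0 < n)%N -> 0 <= lg n.
Proof. by move=> n0; rewrite -lg1 lg_mono. Qed.


Definition mangoldt n : R := if primes n is [:: p] then lg p else 0.

Lemma mangoldt_ge0 n : 0 <= mangoldt n.
Proof.
rewrite /mangoldt; case E: (primes n) => [|p [|//]] //; apply: lg_ge0.
have : p \in primes n by rewrite E mem_head.
by rewrite mem_primes => /andP[/prime_gt0].
Qed.

Lemma mangoldt_neq0 n : mangoldt n != 0 -> exists p k, prime p /\ n = (p ^ k)%N.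
Proof.
rewrite /mangoldt; case E: (primes n) => [|p [|//]]; rewrite ?eqxx // => _.
have : p \in primes n by rewrite E mem_head.
rewrite mem_primes => /and3P[pp n0 _]; exists p, (logn p n); split=> //.
by rewrite {1}(prod_prime_decomp n0) prime_decompE E /= big_seq1.
Qed.

Let mangoldt_primeM p e : prime p -> (0 < e)%N -> ~~ (p %| e)%N ->
  mangoldt (p * e) = if e == 1%N then lg p else 0.
Proof.
move=> pp e0 pe; case: eqP => [->|/eqP e1]; first by rewrite muln1 /mangoldt primes_prime.
have e2 : (1 < e)%N by rewrite ltn_neqAle eq_sym e1.
rewrite /mangoldt; case E: (primes (p * e)) => [|q [|//]] //.
have inq x : prime x -> (x %| p * e)%N -> x = q.
  move=> px xd; apply/eqP; rewrite -mem_seq1 -E mem_primes px xd muln_gt0 e0.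
  by rewrite (prime_gt0 pp).
have pq := inq p pp (dvdn_mulr _ (dvdnn p)).
have rq := inq _ (pdiv_prime e2) (dvdn_mull p (pdiv_dvd e)).
by move: pe; rewrite pq -rq pdiv_dvd.
Qed.

Let mangoldt_primeMM p e : prime p -> (0 < e)%N -> mangoldt (p * (p * e)) = mangoldt (p * e).
Proof.
move=> pp e0; have p0 := prime_gt0 pp.
rewrite /mangoldt (_ : primes (p * (p * e)) = primes (p * e)) //.
apply/eq_primes => x; rewrite !primesM ?muln_gt0 ?p0 //.
by case: (x \in primes p).
Qed.

(** Write n = p^(k+1) m with p prime to m. The divisors of m give [lg m] by induction; among the
    multiples of p only p, ..., p^(k+1) count, each with [lg p]. *)
Lemma mangoldt_sum n : (0 < n)%N -> \sum_(d <- divisors n) mangoldt d = lg n.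
Proof.
elim/ltn_ind: n => n IH n0; have [n1|n1] := leqP n 1.
  have -> : n = 1%N by lia.
  by rewrite /divisors /= big_seq1 lg1.
have pp := pdiv_prime n1; set p := pdiv n in pp; have p0 := prime_gt0 pp.
have [m pm nE] := pfactor_coprime pp n0.
rewrite prime_coprime // in pm.
have m0 : (0 < m)%N by case: m nE {pm} => // nE; rewrite nE mul0n in n0.
have k0 : (0 < logn p n)%N by rewrite logn_gt0 mem_primes pp n0 pdiv_dvd.
have mn : (m < n)%N.
  rewrite [X in (_ < X)%N]nE -[X in (X < _)%N]muln1 ltn_pmul2l //.
  by rewrite -(expn0 p) ltn_exp2l // prime_gt1.
have S0 : \sum_(d <- divisors m) mangoldt (p * d) = lg p.
  rewrite (bigD1_seq 1%N) ?divisors_uniq ?div1 //=; last by rewrite -dvdn_divisors // dvd1n.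
  rewrite mangoldt_primeM //; last by apply: contra pm; rewrite dvdn1 => /eqP ->; rewrite dvd1n.
  rewrite eqxx big_seq_cond big1 ?addr0 // => d /andP[dm /negbTE d1].
  rewrite -dvdn_divisors // in dm; rewrite mangoldt_primeM ?d1 ?(dvdn_gt0 m0) //.
  by apply: contra pm => /dvdn_trans; apply.
have Sk j : \sum_(d <- divisors (p ^ j * m)) mangoldt (p * d) = lg p *+ j.+1.
  elim: j => [|j IHj]; first by rewrite mul1n.
  rewrite (perm_big _ (perm_divisors_pfactor j pp pm m0)) big_cat big_map /= S0 mulrS.
  congr (_ + _); rewrite -IHj big_seq [RHS]big_seq; apply: eq_bigr => d.
  rewrite -dvdn_divisors ?muln_gt0 ?expn_gt0 ?p0 // => /dvdn_gt0 d0.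
  by rewrite mangoldt_primeMM // d0 // muln_gt0 expn_gt0 p0.
case: (logn p n) k0 nE => // k _ nE; rewrite nE mulnC.
rewrite (perm_big _ (perm_divisors_pfactor k pp pm m0)) big_cat big_map /= Sk IH //.
rewrite lgM ?expn_gt0 ?p0 // addrC; congr (_ + _).
elim: k.+1 => [|j IHj]; first by rewrite lg1.
by rewrite expnS lgM ?expn_gt0 ?p0 // mulrS IHj.
Qed.

Lemma sum_lg_mangoldt N (g : nat -> R) :
  \sum_(1 <= n < N.+1) g n * lg n =
  \sum_(1 <= d < N.+1) mangoldt d * \sum_(1 <= m < (N %/ d).+1) g (d * m)%N.
Proof.
under [RHS]eq_bigr do rewrite mulr_sumr.
rewrite -(sum_divisors N (fun d n => mangoldt d * g n)).
apply: eq_big_nat => n nN; rewrite sum_divisorsE // -mulr_suml mangoldt_sum 1?mulrC //.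
by case/andP: nN.
Qed.

Hypothesis lg_unbounded : forall x, exists2 n, (0 < n)%N & x <= lg n.

(** The share of the principal character. The sum of [lg i] over i <= n+1 coprime to M is at most
    n+1 times the sum in question. For n = 2KM it is at least K [lg K], from the numbers Mj + 1 with
    K < j <= 2K. Hence the sum is at least [lg K] / (4M). *)
Lemma coprime_mangoldt_unbounded (M : nat) (x : R) : (0 < M)%N ->
  exists N0, forall N, (N0 <= N)%N ->
    x <= \sum_(1 <= d < N.+1) (coprime M d)%:R * mangoldt d / d%:R.
Proof.
move=> M0; have [K K0 KP] := lg_unbounded (4 * M%:R * Num.max x 0).
exists (2 * K * M).+1 => N NN.
pose B n := \sum_(1 <= d < n.+1) (coprime M d)%:R * mangoldt d / d%:R.
have mono : B (2 * K * M).+1 <= B N.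
  rewrite /B [X in _ <= X](@big_cat_nat _ _ _ (2 * K * M).+2) //= lerDl.
  by apply: sumr_ge0 => d _; rewrite !mulr_ge0 ?mangoldt_ge0 ?invr_ge0.
apply: le_trans mono; set n := (2 * K * M)%N.
have upper : \sum_(1 <= i < n.+2) (coprime M i)%:R * lg i <= n.+1%:R * B n.+1.
  rewrite (sum_lg_mangoldt n.+1 (fun i => (coprime M i)%:R)) /B mulr_sumr.
  rewrite big_nat [X in _ <= X]big_nat; apply: ler_sum => d /andP[d0 _].
  have dR : 0 < d%:R :> R by rewrite ltr0n.
  have h : \sum_(1 <= m < (n.+1 %/ d).+1) (coprime M (d * m))%:R <=
      (coprime M d)%:R * (n.+1%:R / d%:R) :> R.
    have -> : (coprime M d)%:R * (n.+1%:R / d%:R) = n.+1%:R * ((coprime M d)%:R / d%:R) :> R by ring.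
    apply: (@le_trans _ _ (\sum_(1 <= m < (n.+1 %/ d).+1) (coprime M d)%:R)).
      by apply: ler_sum => m _; rewrite ler_nat coprimeMr; do 2 case: (coprime _ _).
    rewrite sumr_const_nat subn1 /= -[X in X <= _]mulr_natl mulrCA mulrC ler_wpM2l //.
    rewrite ler_pdivlMr // -natrM ler_nat. exact: leq_divM.
  apply: le_trans (ler_wpM2l (mangoldt_ge0 d) h) _.
  rewrite le_eqVlt; apply/orP; left; apply/eqP; ring.
have lower : K%:R * lg K <= \sum_(1 <= i < n.+2) (coprime M i)%:R * lg i.
  rewrite big_nat_recl //= [(coprime _ 1)%:R * _]mulrC lg1 mul0r add0r.
  apply: (@le_trans _ _ (\sum_(1 <= i < n.+1 | (M %| i)%N) lg i)); last first.
    rewrite big_mkcond big_nat [X in _ <= X]big_nat; apply: ler_sum => i /andP[i0 _].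
    case: ifP => [/dvdnP[j ij]|_]; last by rewrite mulr_ge0 ?lg_ge0.
    have -> : coprime M i.+1 by rewrite /coprime ij -addn1 gcdnMDl gcdn1.
    by rewrite mul1r lg_mono.
  rewrite sum_multiples // /n mulnK // mul2n -addnn.
  rewrite (@big_cat_nat _ _ _ K.+1) //=; last by rewrite ltnS leq_addr.
  apply: (@le_trans _ _ (\sum_(K.+1 <= i < (K + K).+1) lg K)).
    by rewrite sumr_const_nat subSS addnK -[X in _ <= X]mulr_natl.
  rewrite -[X in X <= _]add0r lerD //.
    by rewrite big_nat sumr_ge0 // => i /andP[i0 _]; rewrite lg_ge0 // muln_gt0 M0.
  rewrite [X in X <= _]big_nat [X in _ <= X]big_nat; apply: ler_sum => i /andP[i0 _].
  by rewrite lg_mono // (leq_trans (ltnW i0)) // leq_pmull.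
have : n.+1%:R <= 4 * M%:R * K%:R :> R by rewrite -!natrM ler_nat /n; nia.
have KR : 0 < K%:R :> R by rewrite ltr0n.
have MR : 0 < M%:R :> R by rewrite ltr0n.
have := le_trans lower upper.
have : x <= Num.max x 0 by rewrite le_max lexx.
have : 0 <= Num.max x 0 by rewrite le_max lexx orbT.
move: (Num.max x 0) KP => y; move: (B n.+1) (lg K) => b l h1 h2 h3 h4 h5.
have nR : 0 < n.+1%:R :> R by rewrite ltr0n.
apply: le_trans h3 _; rewrite leNgt; apply/negP => yb.
have : n.+1%:R * b < K%:R * l.
  apply: lt_le_trans (_ : n.+1%:R * y <= _); first by rewrite ltr_pM2l.
  apply: le_trans (ler_wpM2r h2 h5) _; nra.
lra.
Qed.

Hypothesis lgS : forall n, (0 < n)%N -> lg n.+1 - lg n <= n%:R^-1.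

Let lg_le n : (0 < n)%N -> lg n <= n%:R.
Proof.
elim: n => // -[|n] IH _; first by rewrite lg1.
have := lgS (ltn0Sn n); have := IH isT.
have : n.+1%:R^-1 <= 1 :> R by rewrite invf_le1 ?ltr0n // ler1n.
by rewrite -[n.+2%:R]natr1; move: (n.+1%:R^-1) => y; lra.
Qed.

Lemma mangoldt_le n : (0 < n)%N -> mangoldt n <= n%:R.
Proof.
move=> n0; rewrite /mangoldt; case E: (primes n) => [|p [|q s]]; rewrite ?ler0n //.
have : p \in primes n by rewrite E mem_head.
rewrite mem_primes => /and3P[/prime_gt0 p0 _ pn]; apply: le_trans (lg_le p0) _.
by rewrite ler_nat dvdn_leq.
Qed.

Definition psi N := \sum_(1 <= d < N.+1) mangoldt d.

(** Chebyshev's argument: the difference of log factorials is the logarithm of the central binomial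
    coefficient, at most 2k [lg 2], and d contributes to it floor(2k/d) - 2 floor(k/d) times, which
    is 1 for k < d <= 2k. *)
Lemma psi_double k : psi (2 * k) - psi k <= (2 * k)%:R.
Proof.
have lgE N : \sum_(1 <= n < N.+1) lg n = \sum_(1 <= d < N.+1) mangoldt d * (N %/ d)%:R.
  under eq_bigr do rewrite -[lg _]mul1r.
  by rewrite sum_lg_mangoldt; under eq_bigr do rewrite sumr_const_nat subn1.
have ext : \sum_(1 <= d < k.+1) mangoldt d * (k %/ d)%:R =
    \sum_(1 <= d < (2 * k).+1) mangoldt d * (k %/ d)%:R.
  rewrite [RHS](@big_cat_nat _ _ _ k.+1) //=; last by rewrite ltnS leq_pmull.
  rewrite [X in _ + X]big_nat [X in _ + X]big1 ?addr0 // => d /andP[kd _].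
  by rewrite divn_small // mulr0.
have extpsi : psi k = \sum_(1 <= d < (2 * k).+1) mangoldt d * (d <= k)%N%:R.
  rewrite [RHS](@big_cat_nat _ _ _ k.+1) //=; last by rewrite ltnS leq_pmull.
  rewrite [X in _ + X]big_nat [X in _ + X]big1 ?addr0; last first.
    by move=> d /andP[kd _]; rewrite leqNgt kd mulr0.
  by apply: eq_big_nat => d /andP[_]; rewrite ltnS => ->; rewrite mulr1.
have upper : \sum_(1 <= n < (2 * k).+1) lg n <= 2 * \sum_(1 <= n < k.+1) lg n + (2 * k)%:R.
  elim: k {ext extpsi} => [|k IH]; first by rewrite !big_geq // mulr0 addr0.
  rewrite (_ : (2 * k.+1)%N = (2 * k).+2); last by lia.
  rewrite big_nat_recr //= big_nat_recr //= [X in _ <= 2 * X + _]big_nat_recr //= mulrDr.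
  have h1 : lg (2 * k).+1 <= lg 2 + lg k.+1 by rewrite -lgM // lg_mono // mulnS.
  have h2 : lg (2 * k).+2 = lg 2 + lg k.+1 by rewrite -lgM // mulnS.
  have h3 : lg 2 <= 1 by have := lgS (ltn0Sn 0); rewrite lg1 invr1 subr0.
  rewrite h2 -2!natr1; lra.
have lower : psi (2 * k) - psi k <=
    \sum_(1 <= n < (2 * k).+1) lg n - 2 * \sum_(1 <= n < k.+1) lg n.
  rewrite !lgE ext extpsi mulr_sumr -!sumrB big_nat [X in _ <= X]big_nat.
  apply: ler_sum => d /andP[d0 d2k'].
  have d2k : (0 < d)%N -> (k < d)%N -> (0 < (2 * k) %/ d)%N by move=> *; rewrite divn_gt0 // -ltnS.
  have L0 := mangoldt_ge0 d.
  have : (1 + 2 * (k %/ d) <= (2 * k) %/ d + (d <= k))%N.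
    have [dk|kd] := leqP d k; last first.
      have := d2k d0 kd; rewrite (divn_small kd); lia.
    by rewrite addn1 add1n ltnS leq_divRL // -mulnA leq_mul2l leq_divM.
  by rewrite -(ler_nat R) !(natrD, natrM); nra.
by apply: le_trans lower _; lra.
Qed.

(** Halving induction: with h = floor(N/2), psi N is at most 4h + 2h + N <= 4N, where the crude
    bound [mangoldt_le] pays for an odd N. *)
Lemma psi_le N : psi N <= (4 * N)%:R.
Proof.
elim/ltn_ind: N => N IH; have [->|N0] := posnP N; first by rewrite /psi big_geq.
have half : (N./2 < N)%N by rewrite ltn_half_double -addnn -[X in (X < _)%N]addn0 ltn_add2l.
have := psi_double N./2; have := IH _ half.
have Ndec : psi N <= psi (2 * N./2) + N%:R.
  rewrite -{1}(odd_double_half N) mul2n; case E: (odd N); last by rewrite add0n lerDl.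
  rewrite add1n /psi big_nat_recr //= lerD2l; apply: le_trans (mangoldt_le _) _ => //.
  by rewrite ler_nat; have := odd_double_half N; rewrite E; lia.
have : (4 * N./2 + 2 * N./2 + N <= 4 * N)%N by lia.
rewrite -(ler_nat R) !(natrD, natrM); lra.
Qed.

Hypothesis lg4 : 1 <= lg 4.

Section Character.
Variables (chi : nat -> R) (M : nat).
Hypothesis chiM : {morph chi : a b / (a * b)%N >-> a * b}.
Hypothesis chi1 : chi 1%N = 1.
Hypothesis chi_val : forall n, [\/ chi n = 0, chi n = 1 | chi n = -1].
Hypothesis chi_sum : forall a b, `|\sum_(a <= i < b) chi i| <= M%:R.
Hypothesis M_gt0 : (0 < M)%N.

Let chi_norm n : `|chi n| <= 1.
Proof. by case: (chi_val n) => ->; rewrite ?normr0 ?normrN ?normr1. Qed.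

(** Abel summation against [lg n / n], which decreases once [lg n] >= 1; [lg4] guarantees this from
    4 on, and the terms below 4 go into the constant. *)
Lemma char_lg_bound : exists C, forall N, (4 <= N)%N ->
  `|\sum_(1 <= n < N.+1) chi n / n%:R * lg n| <= C.
Proof.
exists (`|\sum_(1 <= n < 4) chi n / n%:R * lg n| + M%:R * (lg 4 / 4)) => N N4.
rewrite (@big_cat_nat _ _ _ 4) //=; last by rewrite ltnW.
apply: le_trans (ler_normD _ _) _; rewrite lerD2l.
under eq_bigr do rewrite mulrAC -mulrA.
apply: (@abel_bound R (fun n => lg n / n%:R)) => [k k4|k k4|k]; last exact: chi_sum.
  by rewrite divr_ge0 ?lg_ge0 //; apply: leq_trans k4.
have k0 : (0 < k)%N by apply: leq_trans k4.
have kR : 0 < k%:R :> R by rewrite ltr0n.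
rewrite ler_pdivrMr ?ltr0n // mulrAC ler_pdivlMr // -natr1.
have := lgS k0; rewrite -(ler_pM2l kR) divff ?gt_eqF //.
have : 1 <= lg k by apply: le_trans lg4 _; rewrite lg_mono.
nra.
Qed.

(* [chi log] is the convolution of [chi * mangoldt] with [chi], so the sum to be bounded, times
   [charA N], differs from the bounded sum of [chi n * log n / n] by [O(psi N / N)]. *)
Lemma char_mangoldt_bound : exists C D, forall N, (D <= N)%N ->
  `|\sum_(1 <= d < N.+1) chi d * mangoldt d / d%:R| <= C.
Proof.
have [C CP] := char_lg_bound.
have [c c0 [D DP]] := charA_lower chiM chi1 chi_val chi_sum M_gt0.
exists ((C + 4 * M%:R) / c), (maxn D 4) => N; rewrite geq_max => /andP[DN N4].
have N0 : 0 < N%:R :> R by rewrite ltr0n; apply: leq_trans N4.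
have A0 := DP N DN; have A1 : 0 < charA chi N by apply: lt_le_trans A0.
set B := \sum_(_ <= _ < _) _.
have lgE : \sum_(1 <= n < N.+1) chi n / n%:R * lg n =
    \sum_(1 <= d < N.+1) chi d * mangoldt d / d%:R * charA chi (N %/ d).
  rewrite (sum_lg_mangoldt N (fun n => chi n / n%:R)); apply: eq_bigr => d _.
  rewrite /charA !mulr_sumr; apply: eq_bigr => m _.
  by rewrite chiM natrM invfM; ring.
have diff : `|B * charA chi N - \sum_(1 <= n < N.+1) chi n / n%:R * lg n| <= 4 * M%:R.
  rewrite lgE /B mulr_suml -sumrB; apply: le_trans (ler_norm_sum _ _ _) _.
  (* Replacing [charA (N %/ d)] by [charA N] costs at most M d/N; multiplied by [mangoldt d / d]
     this is independent of d except for [mangoldt d], and [psi_le] applies. *)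
  have : \sum_(1 <= d < N.+1) mangoldt d * (M%:R / N%:R) <= 4 * M%:R.
    rewrite -mulr_suml mulrA ler_pdivrMr // mulrAC ler_wpM2r //.
    by have := psi_le N; rewrite natrM.
  apply: le_trans; rewrite big_nat [X in _ <= X]big_nat; apply: ler_sum => d /andP[d0 _].
  have dR : 0 < d%:R :> R by rewrite ltr0n.
  rewrite -mulrBr normrM normrM normrM [`|mangoldt d|]ger0_norm ?mangoldt_ge0 //.
  rewrite [`|d%:R^-1|]ger0_norm ?invr_ge0 ?ler0n //.
  have := charA_dist chi_sum (leq_div N d).
  have le : M%:R / (N %/ d).+1%:R <= M%:R / N%:R * d%:R :> R.
    rewrite ler_pdivrMr ?ltr0n // mulrAC -!mulrA ler_peMr // mulrC ler_pdivlMr //.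
    by rewrite mul1r -natrM ler_nat; have := ltn_ceil N d0; nia.
  move=> /le_trans /(_ le) {}le.
  have h1 : `|chi d| * mangoldt d / d%:R <= mangoldt d / d%:R.
    by rewrite ler_wpM2r ?invr_ge0 // ler_piMl ?mangoldt_ge0.
  have h0 : 0 <= `|chi d| * mangoldt d / d%:R by rewrite !mulr_ge0 ?mangoldt_ge0 ?invr_ge0.
  apply: le_trans (ler_pM h0 (normr_ge0 _) h1 le) _.
  rewrite le_eqVlt; apply/orP; left; apply/eqP; field; by rewrite ?gt_eqF.
rewrite ler_pdivlMr //; apply: le_trans (_ : `|B| * charA chi N <= _).
  by rewrite ler_wpM2l.
have -> : `|B| * charA chi N = `|B * charA chi N| by rewrite normrM (gtr0_norm A1).
have := CP N N4; move: diff; set X := B * _; set Y := \sum_(_ <= _ < _) _ => h1 h2.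
have -> : X = Y + (X - Y) by ring.
by apply: le_trans (ler_normD _ _) (lerD _ _).
Qed.

End Character.

End Mangoldt.

(** * Real characters of the units modulo M *)

(** Take a subgroup K maximal among those containing all squares but not a. For x outside K,
    maximality puts a in the group generated by K and x, and modulo squares a = kx. So the
    complement of K is the single coset of a, K has index 2, and [f] is its indicator. *)
Lemma abelian_square_separation (gT : finGroupType) (a : gT) :
    (forall x y : gT, (x * y = y * x)%g) -> (forall s : gT, (s ^+ 2)%g != a) ->
  exists2 f : gT -> bool, {morph f : x y / (x * y)%g >-> x (+) y} & f a.
Proof.
move=> comm nsq.
have sqG : group_set [set (x ^+ 2)%g | x in [set: gT]].
  apply/group_setP; split; first by apply/imsetP; exists 1%g; rewrite ?inE ?expg1n.
  move=> _ _ /imsetP[x _ ->] /imsetP[y _ ->]; apply/imsetP; exists (x * y)%g; rewrite ?inE //.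
  by rewrite expgMn //; apply: comm.
pose S := group sqG; pose gP (K : {group gT}) := (a \notin K) && (S \subset K).
have [|K /maxgroupP[/andP[aK SK] Kmax] _] := @maxgroup_exists _ gP S.
  rewrite /gP subxx andbT; apply/imsetP => -[s _ sa].
  by move: (nsq s); rewrite sa eqxx.
have sqK x : (x ^+ 2)%g \in K by apply: (subsetP SK); apply/imsetP; exists x; rewrite ?inE.
have out x : x \notin K -> exists2 k, k \in K & a = (k * x)%g.
  move=> xK; have : a \in (K <*> <[x]>)%G.
    apply/negPn/negP => aJ; case/negP: xK.
    have <- : (K <*> <[x]>)%G :=: K by apply: Kmax; rewrite /gP ?aJ ?(subset_trans SK) ?joing_subl.
    by rewrite mem_gen // inE cycle_id orbT.
  have cK : <[x]>%g \subset 'C(K)%g.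
    by apply/subsetP => y _; apply/centP => z _; apply: comm.
  rewrite /= cent_joinEr // => /mulsgP[k _ kK /cycleP[i ->] aE].
  have xi : (x ^+ (i./2).*2)%g \in K by rewrite -mul2n expgM groupX.
  move: aE; rewrite -(odd_double_half i) expgD; case: (odd i) => aE; last first.
    by move: aK; rewrite aE expg0 mul1g groupM.
  exists (k * x ^+ (i./2).*2)%g; first by rewrite groupM.
  by rewrite aE expg1 -mulgA (comm x).
exists (fun x => x \notin K) => // x y /=.
have [xK|xK] := boolP (x \in K); first by rewrite groupMl.
have [yK|yK] := boolP (y \in K); first by rewrite groupMr // (negbTE xK).
have [k kK aE] := out x xK; have [k' kK' aE'] := out y yK.
suff -> : (x * y = k^-1 * k'^-1 * a ^+ 2)%g.
  by rewrite (groupM (groupM _ _) (sqK a)) ?groupV.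
rewrite expgS expg1 !mulgA -(mulgA k^-1%g) (comm k'^-1%g a) mulgA {1}aE mulKg.
by rewrite -mulgA aE' mulKg.
Qed.

Section UnitCharacters.
Variables (R : realFieldType) (m : nat).
Local Notation M := m.+2.
Local Notation U := {unit 'Z_M}.

(** A real character is stored as the exponent of -1, a homomorphism to booleans under xor. This
    places all of them in a finite type over which one can sum and choose. *)
Definition unit_character (f : {ffun U -> bool}) := [forall x, forall y, f (x * y)%g == f x (+) f y].

Lemma unit_characterP (f : {ffun U -> bool}) : reflect {morph f : x y / (x * y)%g >-> x (+) y} (unit_character f).
Proof.
apply: (iffP idP) => [/forallP h x y|h]; first by have /forallP /(_ y) /eqP := h x.
by apply/forallP => x; apply/forallP => y; rewrite h.
Qed.

Definition residue_char (f : {ffun U -> bool}) (x : 'Z_M) : R :=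
  if insub x is Some u then (-1) ^+ f u else 0.

Definition nat_char f (n : nat) := residue_char f n%:R.

Section Properties.
Variable f : {ffun U -> bool}.
Hypothesis fX : unit_character f.
Let fM := unit_characterP f fX.

Let f1 : f 1%g = false.
Proof. by have := fM 1%g 1%g; rewrite mulg1; case: (f 1%g). Qed.

Lemma residue_charM : {morph residue_char f : x y / x * y}.
Proof.
move=> x y; rewrite /residue_char.
case: (insubP U x) => [u xu ux|xN]; last first.
  by rewrite mul0r insubN // unitrM (negbTE xN).
case: (insubP U y) => [v yv vy|yN]; last first.
  by rewrite mulr0 insubN // unitrM (negbTE yN) andbF.
have -> : x * y = val (u * v)%g by rewrite -ux -vy.
by rewrite valK fM signr_addb.
Qed.

Lemma residue_char_unit u : residue_char f (val u) = (-1) ^+ f u.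
Proof. by rewrite /residue_char valK. Qed.

Lemma nat_charM : {morph nat_char f : a b / (a * b)%N >-> a * b}.
Proof. by move=> a b; rewrite /nat_char natrM residue_charM. Qed.

Lemma nat_char1 : nat_char f 1 = 1.
Proof. by rewrite /nat_char -[1%:R]/(val (1%g : U)) residue_char_unit f1. Qed.

Lemma nat_char_val n : [\/ nat_char f n = 0, nat_char f n = 1 | nat_char f n = -1].
Proof.
rewrite /nat_char /residue_char; case: insub => [u|]; last by constructor 1.
by case: (f u); [constructor 3 | constructor 2].
Qed.

(** Multiplication by [u] permutes the residues and negates the sum over a full period, which thus
    vanishes. Partial sums are therefore periodic, and any two differ by fewer than M terms of size
    at most 1. *)
Lemma nat_char_sum u a b : f u -> `|\sum_(a <= i < b) nat_char f i| <= M%:R.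
Proof.
move=> fu; pose S n := \sum_(0 <= i < n) nat_char f i.
have norm1 n : `|nat_char f n| <= 1.
  by case: (nat_char_val n) => ->; rewrite ?normr0 ?normrN ?normr1.
have S0 : S M = 0.
  have -> : S M = \sum_(x : 'Z_M) residue_char f x.
    by rewrite /S big_mkord; apply: eq_bigr => i _; rewrite /nat_char natr_Zp.
  set s := \sum_(x : 'Z_M) _.
  suff : s = - s by lra.
  rewrite {1}/s (reindex_inj (mulIr (valP u))) /= -sumrN; apply: eq_bigr => x _.
  by rewrite residue_charM residue_char_unit fu mulrN1.
have per n : nat_char f (M + n) = nat_char f n.
  by rewrite /nat_char natrD -[M in LHS]/((Zp_trunc M).+2) pchar_Zp // add0r.
have Sper n : S (M + n)%N = S n.
  rewrite /S (@big_cat_nat _ _ _ M) ?leq_addr //= -/(S M) S0 add0r.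
  by rewrite -{1}[M]add0n big_addn addKn; apply: eq_bigr => i _; rewrite addnC per.
have Smod n : S n = S (n %% M)%N.
  rewrite {1}(divn_eq n M); elim: (n %/ M)%N => [|q IH]; first by rewrite mul0n.
  by rewrite mulSn -addnA Sper.
have bound x y : (x <= y)%N -> (y <= M)%N -> `|S y - S x| <= M%:R.
  move=> xy yM; rewrite /S (@big_cat_nat _ _ _ x 0 y) //= addrAC subrr add0r.
  apply: le_trans (ler_norm_sum _ _ _) _; apply: le_trans (ler_sum _ (fun i _ => norm1 i)) _.
  by rewrite sumr_const_nat ler_nat (leq_trans (leq_subr _ _)).
have [ab|ba] := leqP a b; last by rewrite big_geq ?normr0 // ltnW.
have -> : \sum_(a <= i < b) nat_char f i = S b - S a.
  by rewrite /S (@big_cat_nat _ _ _ a 0 b) //= addrAC subrr add0r.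
rewrite (Smod a) (Smod b); have [h|h] := leqP (a %% M)%N (b %% M)%N.
  by rewrite bound // ltnW // ltn_pmod.
by rewrite distrC bound // ?(ltnW h) // ltnW // ltn_pmod.
Qed.

End Properties.

(** Translation by a character that is -1 at u pairs off the terms; such a character exists because
    u is not a square. *)
Lemma char_orthogonality (u : U) : (forall s : U, (s ^+ 2)%g != u) ->
  \sum_(f | unit_character f) (-1) ^+ f u = 0 :> R.
Proof.
move=> nsq; have comm (x y : U) : (x * y = y * x)%g by apply: val_inj; rewrite /= mulrC.
have [g gM gu] := abelian_square_separation comm nsq.
pose t (f : {ffun U -> bool}) := [ffun x => f x (+) g x].
have tK : involutive t by move=> f; apply/ffunP => x; rewrite !ffunE -addbA addbb addbF.
have tX f : unit_character (t f) = unit_character f.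
  suff h k : unit_character k -> unit_character (t k).
    by apply/idP/idP => [/h|/h //]; rewrite tK.
  move=> /unit_characterP kM; apply/unit_characterP => x y; rewrite !ffunE kM gM.
  by case: (k x); case: (k y); case: (g x); case: (g y).
set s := \sum_(f | _) _; suff : s = - s by lra.
rewrite {1}/s (reindex_inj (inv_inj tK)) /= -sumrN.
apply: eq_big => [f|f _]; first exact: tX.
by rewrite ffunE gu signr_addb mulrN1.
Qed.

End UnitCharacters.

(** * The real logarithm, and primes in a coset of the squares *)

Definition lnn (n : nat) : R := ln (INR n).

Lemma INR_gt0 n : (0 < n)%N -> Rlt 0 (INR n).
Proof. by move=> n0; apply/RltP; rewrite INRE ltr0n. Qed.

Lemma lnnM a b : (0 < a)%N -> (0 < b)%N -> lnn (a * b) = lnn a + lnn b.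
Proof. by move=> a0 b0; rewrite /lnn mult_INR ln_mult //; apply: INR_gt0. Qed.

Lemma lnn_mono a b : (0 < a)%N -> (a <= b)%N -> lnn a <= lnn b.
Proof.
move=> a0; rewrite leq_eqVlt => /orP[/eqP ->//|ab]; apply/RleP/Rlt_le/ln_increasing.
  exact: INR_gt0.
by apply/RltP; rewrite !INRE ltr_nat.
Qed.

Lemma lnnS n : (0 < n)%N -> lnn n.+1 - lnn n <= n%:R^-1.
Proof.
move=> n0; have nR := INR_gt0 n0; have n0R : n%:R != 0 :> R by rewrite pnatr_eq0 -lt0n.
have iR : 0 < n%:R^-1 :> R by rewrite invr_gt0 ltr0n.
have -> : lnn n.+1 = lnn n + ln (1 + n%:R^-1).
  rewrite /lnn -RplusE -ln_mult //; last by apply/RltP; rewrite addr_gt0.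
  by rewrite RmultE !INRE mulrDr mulr1 divff // natr1.
rewrite addrAC subrr add0r -[X in _ <= X]ln_exp; apply/RleP.
have : Rle (1 + n%:R^-1) (exp n%:R^-1) by apply: exp_ineq1_le.
case=> [h|->]; last exact: Rle_refl.
by apply/Rlt_le/ln_increasing => //; apply/RltP; rewrite addr_gt0.
Qed.

Lemma lnn4 : 1 <= lnn 4.
Proof.
rewrite (@lnnM 2 2) //; have : 2^-1 < lnn 2 by apply/RltP; rewrite -RinvE; exact: ln_lt_2.
lra.
Qed.

Lemma lnn_unbounded x : exists2 n, (0 < n)%N & x <= lnn n.
Proof.
have [n nx] := INR_unbounded (exp x); have e0 := exp_pos x.
have n0 : Rlt 0 (INR n) by apply: Rlt_trans nx.
exists n; first by move/RltP: n0; rewrite INRE ltr0n.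
by apply/RleP; rewrite -[X in Rle X _]ln_exp; apply/Rlt_le/ln_increasing.
Qed.

(* Only the class of [l] modulo squares matters, so real characters suffice. As [l] is not a square, a
   prime power in the coset is an odd power, whence the prime itself lies in the coset. *)
Lemma prime_in_unit_square_coset (m : nat) (l : {unit 'Z_(m.+2)}) :
    (forall s : {unit 'Z_(m.+2)}, (s ^+ 2)%g != l) ->
  exists p (s : {unit 'Z_(m.+2)}), prime p /\ p%:R = val (l * s ^+ 2)%g.
Proof.
pose U : finGroupType := {unit 'Z_(m.+2)}; rewrite -/U => lnsq.
pose P (f : {ffun U -> bool}) := unit_character f.
pose B (f : {ffun U -> bool}) N := \sum_(1 <= d < N.+1) nat_char R f d * mangoldt lnn d / d%:R.
have comm (x y : U) : (x * y = y * x)%g by apply: val_inj; rewrite /= mulrC.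
have noprime : (forall p (s : U), prime p -> p%:R <> val (l * s ^+ 2)%g) ->
    forall N, \sum_(f | P f) (-1) ^+ f l * B f N = 0.
  move=> no N; under eq_bigr do rewrite mulr_sumr.
  rewrite exchange_big /= big1 // => d _.
  rewrite (eq_bigr (fun f : {ffun U -> bool} => (-1) ^+ f l * nat_char R f d *
    (mangoldt lnn d / d%:R))); last by move=> f _; rewrite !mulrA.
  rewrite -mulr_suml; have [->|L0] := eqVneq (mangoldt lnn d) 0; first by rewrite mul0r mulr0.
  rewrite /nat_char /residue_char; case: (insubP U d%:R) => [u _ ud|_]; last first.
    by rewrite big1 ?mul0r // => f _; rewrite mulr0.
  rewrite (eq_bigr (fun f : {ffun U -> bool} => (-1) ^+ f (l * u)%g)); last first.
    by move=> f /unit_characterP fM; rewrite fM signr_addb.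
  rewrite char_orthogonality ?mul0r // => s; apply/eqP => slu.
  have [p [k [pp dE]]] := mangoldt_neq0 L0.
  (* The exponent k may be 0 here, and then p need not be a unit; w = 1 serves in that case. *)
  have [w [uE wE]] : exists w : U, (u = w ^+ k)%g /\ ((0 < k)%N -> p%:R = val w).
    case: k dE => [|k] dE.
      by exists 1%g; split=> //; apply: val_inj; rewrite ud dE.
    have pu : (p%:R : 'Z_(m.+2)) \is a GRing.unit.
      by have := valP u; rewrite /= ud dE expnS natrM unitrM => /andP[].
    exists (FinRing.unit 'Z_(m.+2) pu); split=> //; apply: val_inj.
    by rewrite ud dE FinRing.val_unitX /= natrX.
  (* From l w^k = s^2: for even k this makes l = z^2 a square, and for odd k it gives w = l (l^-1
     z)^2, a prime in the coset. *)
  set z := (s * (w ^+ k./2)^-1)%g.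
  have l_eq : (l = z ^+ 2 * (w ^+ odd k)^-1)%g.
    rewrite expgMn; last exact: comm.
    by rewrite slu uE expgVn -expgM muln2 -{1}(odd_double_half k) expgD !mulgA !mulgK.
  case k_odd : (odd k) l_eq => l_eq; last first.
    by move: (lnsq z); rewrite l_eq expg0 invg1 mulg1 eqxx.
  have k0 : (0 < k)%N by case: k k_odd {dE wE l_eq uE z}.
  apply: (no p (l^-1 * z)%g pp); rewrite wE //; congr val.
  rewrite expgMn; last exact: comm.
  have -> : (z ^+ 2 = l * w)%g by rewrite l_eq expg1 mulgKV.
  by rewrite expgS expg1 !mulgA mulgV mul1g mulVg mul1g.
apply: NNPP => nex.
have {}noprime := noprime (fun p s pp pE => nex (ex_intro _ p (ex_intro _ s (conj pp pE)))).
(* The principal character. Its sum grows beyond the total [C] of the bounds for all other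
   characters, so the signed sum cannot vanish. *)
pose f0 : {ffun U -> bool} := [ffun => false].
have P0 : P f0 by apply/unit_characterP => x y; rewrite !ffunE.
have /fin_all_exists[CD CDP] : forall f, exists CD : R * nat, P f -> f != f0 ->
    forall N, (CD.2 <= N)%N -> `|B f N| <= CD.1.
  move=> f; have [fP|] := boolP (P f); last by exists (0, 0%N).
  have [->|ff0] := eqVneq f f0; first by exists (0, 0%N).
  have [u fu] : exists u, f u.
    apply/existsP; apply: contraR ff0 => /existsPn nf; apply/eqP/ffunP => x.
    by rewrite ffunE (negbTE (nf x)).
  have [C [D h]] := char_mangoldt_bound lnnM lnn_mono lnnS lnn4 (nat_charM R fP) (nat_char1 R fP)
    (nat_char_val R f) (fun a b => nat_char_sum R fP a b fu) (ltn0Sn _).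
  by exists (C, D).
pose C := \sum_f `|(CD f).1|; pose D := (\max_f (CD f).2)%N.
have [N0 N0P] := coprime_mangoldt_unbounded lnnM lnn_mono lnn_unbounded (C + 1) (ltn0Sn m.+1).
pose N := maxn D N0.
have B0 : C + 1 <= B f0 N.
  apply: le_trans (N0P N (leq_maxr _ _)) _; rewrite le_eqVlt; apply/orP; left; apply/eqP.
  apply: eq_bigr => d _; congr (_ * _ / _); rewrite /nat_char /residue_char.
  by rewrite -unitZpE //; case: insubP => [u -> _|/negbTE ->] //; rewrite ffunE.
have := noprime N; rewrite (bigD1 f0) //= ffunE expr0 mul1r.
suff : `|\sum_(f | P f && (f != f0)) (-1) ^+ f l * B f N| <= C.
  rewrite ler_norml => /andP[+ _]; move: B0; set x := \sum_(_ | _) _; lra.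
apply: le_trans (ler_norm_sum _ _ _) _; rewrite big_mkcond; apply: ler_sum => f _.
case: ifP => // /andP[fP ff0]; rewrite normrM normr_sign mul1r.
apply: le_trans (CDP f fP ff0 N _) (ler_norm _).
by rewrite (leq_trans _ (leq_maxl _ _)) // (leq_bigmax f).
Qed.

Lemma prime_in_square_coset (M l : nat) : (1 < M)%N -> coprime M l ->
    (forall s, (s ^ 2 <> l %[mod M])%N) ->
  exists p s, [/\ prime p, coprime M s & (p = l * s ^ 2 %[mod M])%N].
Proof.
case: M => [|[|m]] // _ lM nsq; set M := m.+2 in lM nsq *.
have modE a b : a%:R = b%:R :> 'Z_M <-> (a = b %[mod M])%N.
  by split=> [/(congr1 val)|h]; [rewrite /= !val_Zp_nat | apply: val_inj; rewrite /= !val_Zp_nat].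
have lu : (l%:R : 'Z_M) \is a GRing.unit by rewrite unitZpE.
have [|p [s [pp pE]]] := @prime_in_unit_square_coset m (FinRing.unit 'Z_(m.+2) lu).
  move=> s; apply/eqP => /(congr1 val); rewrite FinRing.val_unitX /= -[val s]natr_Zp -natrX.
  by move/modE; apply: nsq.
exists p, (val s : nat); split=> //.
  by rewrite -[coprime _ _]/(coprime M _) -unitZpE // natr_Zp (valP s).
by apply/modE; rewrite pE /= FinRing.val_unitX natrM natrX natr_Zp.
Qed.

(** * Quadratic residues *)

(** The field with q^totient(n) elements works: its unit group is cyclic, and Euler's theorem makes
    n divide its order. *)
Lemma finField_prim_root (q n : nat) : prime q -> (1 < n)%N -> coprime q n ->
  exists (K : finFieldType) (z : K), q \in [pchar K] /\ n.-primitive_root z.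
Proof.
move=> qp n1 qn; have n0 := ltnW n1.
have t0 : (0 < totient n)%N by rewrite totient_gt0.
have [K qK cardK] := pPrimePowerField qp t0.
have [x xG] := cyclicP (field_unit_group_cyclic [set: {unit K}]%G).
have ox : #[x]%g = #|K|.-1 by rewrite -card_finField_unit [RHS](congr1 (fun A : {set _} => #|A|) xG).
have nd : (n %| #|K|.-1)%N.
  rewrite cardK -subn1 -eqn_mod_dvd ?expn_gt0 ?prime_gt0 //.
  by apply/eqP; apply: Euler_exp_totient.
have K1 : (0 < #|K|.-1)%N by rewrite -ox order_gt0.
have n'0 : (0 < #|K|.-1 %/ n)%N by rewrite divn_gt0 // dvdn_leq.
pose z := val (x ^+ (#|K|.-1 %/ n))%g.
have zE j : z ^+ j = val (x ^+ (#|K|.-1 %/ n * j))%g by rewrite expgM FinRing.val_unitX.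
have zn : z ^+ n = 1.
  by rewrite zE divnK // -ox expg_order.
have [m mz mn] := prim_order_exists n0 zn.
exists K, z; split=> //; suff <- : m = n by [].
apply/eqP; rewrite eqn_dvd mn /=.
have : z ^+ m = 1 by rewrite (prim_expr_order mz).
rewrite zE => /(congr1 (insub : K -> option {unit K})) /=.
rewrite valK (_ : 1 = val (1%g : {unit K})) // valK => -[/eqP].
by rewrite -order_dvdn ox -{1}(divnK nd) dvdn_pmul2l.
Qed.

Lemma Fp_half_power (p : nat) (a : 'F_p) : prime p -> odd p -> a != 0 ->
  a ^+ (p.-1)./2 = 1 \/ a ^+ (p.-1)./2 = -1.
Proof.
move=> pp podd a0; apply/pred2P; rewrite -sqrf_eq1 -exprM muln2.
apply/eqP/(mulfI a0); rewrite mulr1 -exprS.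
have -> : ((p.-1)./2.*2.+1 = p)%N by have := prime_gt0 pp; lia.
by have := expf_card a; rewrite card_Fp.
Qed.

(** * Gauss sums and quadratic reciprocity for p = 3 mod 4 *)

Section GaussSum.
Variables (p : nat) (K : fieldType) (z : K).
Hypotheses (pp : prime p) (p3 : (p %% 4 = 3)%N) (pz : p.-primitive_root z).
Hypothesis two : (2%:R : K) != 0.

Let h := (p.-1)./2.
Let podd : odd p. Proof. by lia. Qed.
Let pE : p = (h.*2).+1. Proof. by rewrite /h; lia. Qed.
Let h_odd : odd h. Proof. by rewrite /h; lia. Qed.
Let cardF : #|'F_p| = p := card_Fp pp.

Let F2 : (2%:R : 'F_p) != 0.
Proof.
rewrite -(dvdn_pcharf (pchar_Fp pp)); apply/negP => /dvdn_leq; move: p3; lia.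
Qed.

Let F1N : (1 : 'F_p) != -1.
Proof. by rewrite -subr_eq0 opprK; exact: F2. Qed.

(** Euler's criterion serves as the definition. Values lie in [K], later of characteristic q, so
    that they can be compared with powers of elements of [K]. *)
Definition legendre (a : 'F_p) : K := if a == 0 then 0 else if a ^+ h == 1 then 1 else -1.

Lemma legendreM a b : legendre (a * b) = legendre a * legendre b.
Proof.
rewrite /legendre mulf_eq0; have [|a0] := eqVneq a 0; first by rewrite mul0r.
have [|b0] /= := eqVneq b 0; first by rewrite mulr0.
rewrite exprMn; case: (Fp_half_power pp podd a0) => ->; case: (Fp_half_power pp podd b0) => ->;
  rewrite ?mulr1 ?mul1r ?mulrNN ?mulr1 ?eqxx // ?[-1 == 1]eq_sym ?(negbTE F1N) ?mulr1 ?mul1r ?mulrNN ?mulr1 //.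
Qed.

Lemma legendreN1 : legendre (-1) = -1.
Proof.
by rewrite /legendre oppr_eq0 oner_eq0 -signr_odd h_odd expr1 eq_sym (negbTE F1N).
Qed.

Lemma legendre_sum : \sum_a legendre a = 0.
Proof.
set s := \sum_a _; have : s = - s.
  rewrite {1}/s (reindex_inj oppr_inj) /= -sumrN; apply: eq_bigr => a _.
  by rewrite -mulN1r legendreM legendreN1 mulN1r.
move/eqP; rewrite -subr_eq0 opprK -mulr2n -mulr_natr mulf_eq0 (negbTE two) orbF.
by move/eqP.
Qed.

Let e (a : 'F_p) : K := z ^+ (a : nat).

Let e_nat n : e n%:R = z ^+ n.
Proof. by rewrite /e val_Fp_nat // prim_expr_mod. Qed.

Let eD a b : e (a + b) = e a * e b.
Proof. by rewrite -{1}[a]natr_Zp -{1}[b]natr_Zp -natrD e_nat exprD. Qed.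

Let e0 : e 0 = 1. Proof. by []. Qed.

Let e_sum c : \sum_a e (a * c) = if c == 0 then p%:R else 0.
Proof.
case: eqVneq => [->|c0].
  by under eq_bigr do rewrite mulr0 e0; rewrite sumr_const cardF.
have -> : \sum_a e (a * c) = \sum_a e a by rewrite [RHS](reindex_inj (mulIf c0)).
set s := \sum_a _.
have : s = s * e 1.
  rewrite {1}/s (reindex_inj (addIr 1)) /= mulr_suml.
  by apply: eq_bigr => a _; rewrite eD.
have e1 : e 1 != 1.
  rewrite (e_nat 1); apply: contraL (prime_gt1 pp).
  by rewrite -(prim_order_dvd pz) dvdn1 => /eqP ->.
move/eqP; rewrite -subr_eq0 -{1}[s]mulr1 -mulrBr mulf_eq0 subr_eq0 [1 == _]eq_sym (negbTE e1) orbF.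
by move/eqP.
Qed.

Definition gauss_sum := \sum_a legendre a * e a.

Lemma gauss_sum_sqr : gauss_sum ^+ 2 = - p%:R.
Proof.
have l0 : legendre 0 = 0 by rewrite /legendre eqxx.
have lsq a : a != 0 -> legendre a * legendre a = 1.
  rewrite /legendre => /negbTE ->; case: ifP => _; ring.
rewrite expr2 {1}/gauss_sum mulr_suml.
(* In the double sum over a and b put b = ac for a <> 0; the factor [legendre a] then occurs squared
   and disappears. *)
rewrite (eq_bigr (fun a => \sum_c legendre c * ((a != 0)%:R * e (a * (1 + c))))); last first.
  move=> a _; have [->|a0] := eqVneq a 0.
    by rewrite l0 !mul0r big1 // => c _; rewrite mulr0.
  rewrite /gauss_sum (reindex_inj (mulfI a0)) mulr_sumr; apply: eq_bigr => c _.
  rewrite legendreM mulrDr mulr1 eD /= mul1r.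
  transitivity ((legendre a * legendre a) * (legendre c * (e a * e (a * c)))); first by ring.
  by rewrite lsq // mul1r.
rewrite exchange_big /=.
(* Restoring the missing term a = 0, which is 1, completes the inner sum to [e_sum]; only c = -1
   survives. *)
rewrite (eq_bigr (fun c => legendre c * (if c == -1 then p%:R else 0) - legendre c)); last first.
  move=> c _; rewrite -mulr_sumr -{3}[legendre c]mulr1 -mulrBr; congr (_ * _).
  have -> : (c == -1) = (1 + c == 0) by rewrite addrC addr_eq0.
  rewrite -e_sum [in RHS](bigD1 0) //= mul0r e0 addrAC subrr add0r (bigD1 0) //= mul0r add0r.
  by apply: eq_bigr => a /negbTE ->; rewrite mul1r.
rewrite sumrB legendre_sum subr0 (bigD1 (-1)) //= eqxx legendreN1 mulN1r big1 ?addr0 //.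
by move=> c /negbTE ->; rewrite mulr0.
Qed.

Lemma gauss_sum_frobenius q : q \in [pchar K] -> odd q -> p != q ->
  gauss_sum ^+ q = legendre q%:R * gauss_sum.
Proof.
move=> qK qodd pq; have qp := pcharf_prime qK.
have lq a : legendre a ^+ q = legendre a.
  rewrite /legendre; case: ifP => _; first by rewrite expr0n; case: q qp {qK qodd pq}.
  by case: ifP => _; rewrite ?expr1n // -signr_odd qodd.
have q0 : (q%:R : 'F_p) != 0.
  by rewrite -(dvdn_pcharf (pchar_Fp pp)) dvdn_prime2.
have lq2 : legendre q%:R * legendre q%:R = 1.
  by rewrite /legendre (negbTE q0); case: ifP => _; ring.
rewrite -(pFrobenius_autE qK) rmorph_sum /= /gauss_sum [in RHS](reindex_inj (mulfI q0)) mulr_sumr.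
apply: eq_bigr => a _; rewrite pFrobenius_autE exprMn lq legendreM !mulrA lq2 mul1r; congr (_ * _).
by rewrite -[a in RHS]natr_Zp -natrM e_nat /e -exprM mulnC.
Qed.

End GaussSum.

(** Brings identities between integers found in an extension back to the prime field: both sides say
    that p divides n - 1 or n + 1. *)
Lemma pchar_sign_eq (K : fieldType) (p n : nat) (b : bool) : p \in [pchar K] ->
  (0 < n)%N -> (n%:R : K) = (-1) ^+ b -> (n%:R : 'F_p) = (-1) ^+ b.
Proof.
move=> pK n0; have pF := pchar_Fp (pcharf_prime pK); case: b => /=.
  move/eqP; rewrite -subr_eq0 opprK natr1 -(dvdn_pcharf pK) (dvdn_pcharf pF) -natr1.
  by rewrite addr_eq0 => /eqP.
case: n n0 => // n _; rewrite -!natr1 !expr0; move/eqP.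
by rewrite -subr_eq0 addrK -(dvdn_pcharf pK) (dvdn_pcharf pF) => /eqP ->; rewrite add0r.
Qed.

(* The Legendre symbol (2/n), as the exponent of [-1]. *)
Definition mod8_sign (n : nat) : bool := ((n %% 8 == 3) || (n %% 8 == 5))%N.

Lemma mod8_signM a b : odd a -> odd b -> mod8_sign (a * b) = mod8_sign a (+) mod8_sign b.
Proof.
move=> ao bo; rewrite /mod8_sign -modnMm.
have ha : (a %% 8 \in [:: 1; 3; 5; 7])%N by rewrite !inE; lia.
have hb : (b %% 8 \in [:: 1; 3; 5; 7])%N by rewrite !inE; lia.
by move: ha hb; rewrite !inE => /or4P[] /eqP -> /or4P[] /eqP ->.
Qed.

(** The element t = z + 1/z is a square root of 2, and Frobenius sends it to z^q + z^-q = t or -t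
    according to q mod 8. *)
Lemma two_half_power (K : fieldType) (q : nat) (z : K) : q \in [pchar K] -> odd q ->
  8.-primitive_root z -> 2%:R ^+ (q.-1)./2 = (-1) ^+ mod8_sign q :> K.
Proof.
move=> qK qodd z8; have qp := pcharf_prime qK.
have z0 : z != 0 by apply: contraL (oner_neq0 K) => /eqP z0; rewrite -(prim_expr_order z8) z0 expr0n eqxx.
have z4 : z ^+ 4 = -1.
  have : (z ^+ 4) ^+ 2 == 1 by rewrite -exprM (prim_expr_order z8).
  by rewrite sqrf_eq1 -(prim_order_dvd z8) => /= /eqP.
have zV : z^-1 = - z ^+ 3 by apply: (mulfI z0); rewrite divff // mulrN -exprS z4 opprK.
pose t := z + z^-1.
have t2 : t ^+ 2 = 2%:R.
  rewrite /t zV (_ : (z - z ^+ 3) ^+ 2 = z ^+ 2 - 2%:R * z ^+ 4 + z ^+ 4 * z ^+ 2); last by ring.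
  by rewrite z4; ring.
have two : (2%:R : K) != 0.
  rewrite -(dvdn_pcharf qK) dvdn_prime2 //; apply: contraL qodd => /eqP ->.
  by [].
have t0 : t != 0 by apply: contraNneq two => t0; rewrite -t2 t0 expr0n.
have tq : t ^+ q = (-1) ^+ mod8_sign q * t.
  rewrite -(pFrobenius_autE qK) rmorphD fmorphV /= pFrobenius_autE.
  have -> : z ^+ q = z ^+ (q %% 8) by rewrite (prim_expr_mod z8).
  rewrite /mod8_sign /t.
  have : (q %% 8 \in [:: 1; 3; 5; 7])%N by rewrite !inE; lia.
  have e3 : z ^+ 3 = - z^-1 by rewrite zV opprK.
  have e5 : z ^+ 5 = - z by rewrite (exprD z 4 1) z4 mulN1r.
  have e7 : z ^+ 7 = z^-1 by rewrite (exprD z 4 3) z4 mulN1r zV.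
  rewrite !inE => /or4P[] /eqP -> /=.
  - by rewrite mul1r.
  - by rewrite e3 invrN invrK expr1 mulN1r opprD addrC.
  - by rewrite e5 invrN expr1 mulN1r opprD.
  by rewrite e7 invrK mul1r addrC.
apply: (mulIf t0); rewrite -tq -t2 -exprM -exprSr; congr (_ ^+ _).
by case: q qodd qp {qK tq} => //= q; lia.
Qed.

Lemma two_residue (p : nat) : prime p -> odd p ->
  (2%:R : 'F_p) ^+ (p.-1)./2 = (-1) ^+ mod8_sign p.
Proof.
move=> pp podd; have [//||K [z [pK z8]]] := @finField_prim_root p 8 pp.
  by rewrite -[8%N]/(2 ^ 3)%N coprime_pexpr ?coprimen2.
rewrite -natrX; apply: (pchar_sign_eq pK); first by rewrite expn_gt0.
by rewrite natrX; apply: two_half_power z8.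
Qed.

(** Reciprocity: the q-th power of the Gauss sum g is (q/p) g by Frobenius and (-p)^((q-1)/2) g
    because g^2 = -p. *)
Lemma half_power_char (p q : nat) (K : fieldType) (z : K) : prime p -> (p %% 4 = 3)%N ->
    odd q -> p != q -> p.-primitive_root z -> q \in [pchar K] -> (2%:R : K) != 0 ->
  (- p%:R) ^+ (q.-1)./2 = legendre K (q%:R : 'F_p).
Proof.
move=> pp p3 qodd pq pz qK two.
have g2 := gauss_sum_sqr pp p3 pz two.
have p0 : (p%:R : K) != 0.
  by rewrite -(dvdn_pcharf qK) dvdn_prime2 ?(pcharf_prime qK) // eq_sym.
have g0 : gauss_sum p z != 0.
  by apply: contraNneq p0 => g0; rewrite -oppr_eq0 -g2 g0 expr0n.
apply: (mulIf g0); rewrite -gauss_sum_frobenius // -g2 -exprM -exprSr; congr (_ ^+ _).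
by have := pcharf_prime qK; case: q qodd {pq qK} => //= q; lia.
Qed.

Lemma legendre_eq (K : fieldType) (p q : nat) (b : bool) : prime p -> (2%:R : K) != 0 ->
    legendre K (q%:R : 'F_p) = (-1) ^+ b -> (p %% 4 = 3)%N ->
  (q%:R : 'F_p) ^+ (p.-1)./2 = (-1) ^+ b.
Proof.
move=> pp two + p3; have N1 : (1 : K) != -1 by rewrite -subr_eq0 opprK.
rewrite /legendre; case: eqVneq => [_ /eqP|q0].
  by rewrite eq_sym signr_eq0.
case: eqP => [-> | nq]; case: b; rewrite ?expr0 ?expr1 //.
- by move/eqP; rewrite (negbTE N1).
- by case: (Fp_half_power pp _ q0) => //; lia.
by move/eqP; rewrite eq_sym (negbTE N1).
Qed.

(** Modulo q, -p is s^2 in the first case and 2s^2 in the second, so (q/p) = (-p/q) is 1 or (2/q).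
    An 8p-th root of unity supplies both the Gauss sum and the square root of 2. *)
Lemma residue_of_prime_factor (p q s : nat) : prime p -> (p %% 4 = 3)%N -> prime q -> odd q ->
    ~~ (q %| s)%N -> p != q ->
  ((q %| p + s ^ 2)%N -> (q%:R : 'F_p) ^+ (p.-1)./2 = 1) /\
  ((q %| p + 2 * s ^ 2)%N -> (q%:R : 'F_p) ^+ (p.-1)./2 = (-1) ^+ mod8_sign q).
Proof.
move=> pp p3 qp qodd qs pq.
have cop : coprime q (8 * p).
  rewrite coprimeMr; apply/andP; split; last by rewrite prime_coprime // dvdn_prime2 // eq_sym.
  by rewrite -[8%N]/(2 ^ 3)%N coprime_pexpr ?coprimen2.
have [|K [z [qK z8p]]] := finField_prim_root qp _ cop; first by have := prime_gt0 pp; lia.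
have z8 : 8.-primitive_root (z ^+ p) by have := dvdn_prim_root z8p (dvdn_mulr p (dvdnn 8)); rewrite mulKn.
have zp : p.-primitive_root (z ^+ 8) 
  by have := dvdn_prim_root z8p (dvdn_mull 8 (dvdnn p)); rewrite mulnK ?prime_gt0.
have two : (2%:R : K) != 0.
  by rewrite -(dvdn_pcharf qK) dvdn_prime2 //; apply: contraL qodd => /eqP ->.
have s0 : (s%:R : K) != 0 by rewrite -(dvdn_pcharf qK).
have s1 : (s%:R ^+ 2) ^+ (q.-1)./2 = 1 :> K.
  have sq : s%:R ^+ q = s%:R :> K.
    by rewrite -(pFrobenius_autE qK) pFrobenius_aut_nat.
  apply: (mulfI s0); rewrite -exprM -exprS mulr1 -[RHS]sq; congr (_ ^+ _).
  by case: q qodd qp {qs pq cop z8p qK s0 sq} => //= q; lia.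
have H := half_power_char pp p3 qodd pq zp qK two.
split=> qd.
  rewrite -[1]/((-1) ^+ false); apply: (legendre_eq pp two _ p3); rewrite -H.
  have -> : - p%:R = s%:R ^+ 2 :> K.
    by apply/eqP; rewrite eq_sym -addr_eq0 -natrX -natrD addnC -(dvdn_pcharf qK).
  by rewrite s1.
apply: (legendre_eq pp two _ p3); rewrite -H.
have -> : - p%:R = 2%:R * s%:R ^+ 2 :> K.
  by apply/eqP; rewrite eq_sym -addr_eq0 -natrX -natrM -natrD addnC -(dvdn_pcharf qK).
by rewrite exprMn s1 mulr1; apply: two_half_power z8.
Qed.

Lemma square_of_half_power (p m : nat) : prime p -> (p %% 4 = 3)%N ->
  (m%:R : 'F_p) ^+ (p.-1)./2 = 1 -> exists r, (r ^ 2 = m %[mod p])%N.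
Proof.
move=> pp p3 m1; exists (m ^ (p.+1 %/ 4))%N.
rewrite -!(val_Fp_nat pp); congr val.
rewrite natrX natrX -exprM (_ : _ * 2 = (p.-1)./2.+1)%N; last by lia.
by rewrite exprS m1 mulr1.
Qed.

(** * Auxiliary primes satisfying Legendre's conditions *)

(** Additivity of [b] is asked only on divisors of m, since [mod8_sign] has it only on odd
    numbers. *)
Lemma half_power_mult (p m : nat) (b : nat -> bool) : (0 < m)%N ->
    b 1%N = false ->
    (forall q n, prime q -> (q * n %| m)%N -> b (q * n)%N = b q (+) b n) ->
    (forall q, prime q -> (q %| m)%N -> (q%:R : 'F_p) ^+ (p.-1)./2 = (-1) ^+ b q) ->
  (m%:R : 'F_p) ^+ (p.-1)./2 = (-1) ^+ b m.
Proof.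
move=> m0 b1 bM bq; suff: forall n, (n %| m)%N -> (n%:R : 'F_p) ^+ (p.-1)./2 = (-1) ^+ b n by apply.
elim/ltn_ind => n IH nm; have n0 := dvdn_gt0 m0 nm; have [n1|n1] := leqP n 1.
  by rewrite (_ : n = 1%N) ?b1 ?mulr1n ?expr1n; last lia.
have qp := pdiv_prime n1; have /dvdnP[k nE] := pdiv_dvd n; set q := pdiv n in qp nE.
have kn : (k < n)%N by have := prime_gt1 qp; nia.
have kq : (q * k %| m)%N by rewrite mulnC -nE.
rewrite nE mulnC natrM exprMn bM // signr_addb bq //; last exact: dvdn_trans (dvdn_mulr _ _) kq.
by rewrite IH //; exact: dvdn_trans (dvdn_mull _ _) kq.
Qed.

Lemma coprime_odd_sqr_mod8 s : coprime 2 s -> (s ^ 2 %% 8 = 1)%N.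
Proof.
rewrite coprime2n => so.
have : (s %% 8 \in [:: 1; 3; 5; 7])%N by rewrite !inE; lia.
by rewrite -modnXm !inE => /or4P[] /eqP ->.
Qed.

Lemma coprime3_sqr_mod3 s : coprime 3 s -> (s ^ 2 %% 3 = 1)%N.
Proof.
rewrite prime_coprime // => s3.
have : (s %% 3 \in [:: 1; 2])%N by rewrite !inE; lia.
by rewrite -modnXm !inE => /orP[] /eqP ->.
Qed.

Lemma exists_prime_minus_square (m : nat) : (0 < m)%N -> ~~ (3 %| m)%N ->
  exists p s r, [/\ prime p, (p %% 3 = 1)%N, coprime p m, (m %| p + s ^ 2)%N & (r ^ 2 = m %[mod p])%N].
Proof.
(* This [l] is -1 modulo m, 7 modulo 8 and, as m^2 = 1 mod 3, also 1 modulo 3. The class 7 modulo 8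
   makes 2 a residue of p, which allows even m. *)
move=> m0 m3; pose M := (24 * m)%N; pose l := (8 * m ^ 2 - 1)%N.
have lE : (l + 1 = 8 * m ^ 2)%N by rewrite /l; nia.
have m2 := coprime3_sqr_mod3 (_ : coprime 3 m).
have {}m2 : (m ^ 2 %% 3 = 1)%N by apply: m2; rewrite prime_coprime.
have lM : coprime M l.
  have : coprime (8 * m ^ 2) l by rewrite -lE addn1 coprimeSn.
  rewrite /M !coprimeMl => /andP[c8 /andP[-> _]].
  rewrite andbT (_ : 24 = 3 * 8)%N // coprimeMl c8 andbT prime_coprime //.
  lia.
have nsq s : (s ^ 2 <> l %[mod M])%N.
  move=> /(congr1 (modn^~ 4)); rewrite !modn_dvdm ?dvdn_mulr //.
  have : (s %% 4 \in [:: 0; 1; 2; 3])%N by rewrite !inE; lia.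
  have -> : (l %% 4 = 3)%N by lia.
  by rewrite -modnXm !inE => /or4P[] /eqP ->.
have M1 : (1 < M)%N by rewrite /M; lia.
have [p [s [pp sM pE]]] := prime_in_square_coset M1 lM nsq.
have redM d : (d %| M)%N -> (p = l * s ^ 2 %[mod d])%N.
  by move=> dM; move/(congr1 (modn^~ d)): pE; rewrite !modn_dvdm.
have [s2 [s3 sm]] : coprime 2 s /\ coprime 3 s /\ coprime m s.
  by move: sM; rewrite /M (_ : 24 = 2 * 2 * 2 * 3)%N // !coprimeMl => /andP[/andP[/andP[_ ->] ->] ->].
have s8 := coprime_odd_sqr_mod8 s2; have s3' := coprime3_sqr_mod3 s3.
have p3 : (p %% 3 = 1)%N.
  rewrite redM ?dvdn_mulr // -modnMm s3' muln1 modn_mod. lia.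
have p8 : (p %% 8 = 7)%N.
  rewrite redM ?dvdn_mulr // -modnMm s8 muln1 modn_mod. lia.
have mps : (m %| p + s ^ 2)%N.
  rewrite /dvdn -(modnDml p) (redM m) ?dvdn_mull // modnDml.
  rewrite (_ : _ + _ = m * (8 * m * s ^ 2))%N ?modnMr //.
  by rewrite -[X in (_ + X)%N]mul1n -mulnDl lE; ring.
have p4 : (p %% 4 = 3)%N by lia.
have po : odd p by lia.
have [r rE] : exists r, (r ^ 2 = m %[mod p])%N.
  apply: square_of_half_power => //.
  rewrite (@half_power_mult p m (fun _ => false)) // => q qp qm.
  have qs : ~~ (q %| s)%N by rewrite -prime_coprime // (coprime_dvdl qm).
  have pq : p != q.
    apply: contraNneq qs => pq; have := dvdn_trans qm mps.
    by rewrite -pq dvdn_addr ?dvdnn // Euclid_dvdX // andbT.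
  have [q2|q2] := eqVneq q 2%N.
    by rewrite q2 (two_residue pp po) /mod8_sign p8.
  have qo : odd q by have := even_prime qp; case => [/eqP|//]; rewrite (negbTE q2).
  by apply: (residue_of_prime_factor pp p4 qp qo qs pq).1; apply: dvdn_trans mps.
exists p, s, r; split=> //; rewrite prime_coprime //; apply/negP => pm.
have : (p %| s)%N by have := dvdn_trans pm mps; rewrite dvdn_addr ?dvdnn // Euclid_dvdX // andbT.
by apply/negP; rewrite -prime_coprime // (coprime_dvdl pm).
Qed.

Lemma exists_prime_minus_two_square (m t : nat) : odd m -> (t == 3) || (t == 7) ->
  exists p s, [/\ prime p, (p %% 3 = 1)%N, (p %% 8 = t)%N, coprime p m & (m %| p + 2 * s ^ 2)%N /\
    (m%:R : 'F_p) ^+ (p.-1)./2 = (-1) ^+ mod8_sign m].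
Proof.
move=> mo t37; have m0 : (0 < m)%N by case: m mo.
(* This [l] is -2 modulo m, 1 modulo 3 and, as 9m^2 = 1 mod 8, equal to t modulo 8. *)
pose M := (24 * m)%N; pose l := (9 * m ^ 2 * (t + 2) - 2)%N.
have lE : (l + 2 = 9 * m ^ 2 * (t + 2))%N by rewrite /l; nia.
have m8 : (m ^ 2 %% 8 = 1)%N by apply: coprime_odd_sqr_mod8; rewrite coprime2n.
have l8 : (l %% 8 = t)%N by case/orP: t37 lE => /eqP ->; lia.
have l3 : (l %% 3 = 1)%N by lia.
have lo : odd l by case/orP: t37 l8 => /eqP ->; lia.
have lM : coprime M l.
  rewrite /M (_ : 24 = 3 * 2 ^ 3)%N // !coprimeMl !coprime2n lo prime_coprime // /dvdn l3 /=.
  have g2 : (gcdn m l %| 2)%N.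
    rewrite -(dvdn_addr _ (dvdn_gcdr m l)) lE dvdn_mulr // dvdn_mull //.
    by apply: dvdn_mulr; apply: dvdn_gcdl.
  have := dvdn_odd (dvdn_gcdl m l) mo; have := dvdn_leq (isT : (0 < 2)%N) g2.
  by rewrite /coprime; case: (gcdn m l) => [|[|[|]]].
have nsq s : (s ^ 2 <> l %[mod M])%N.
  move=> /(congr1 (modn^~ 4)); rewrite !modn_dvdm ?dvdn_mulr //.
  have : (s %% 4 \in [:: 0; 1; 2; 3])%N by rewrite !inE; lia.
  have -> : (l %% 4 = 3)%N by case/orP: t37 l8 => /eqP ->; lia.
  by rewrite -modnXm !inE => /or4P[] /eqP ->.
have M1 : (1 < M)%N by rewrite /M; lia.
have [p [s [pp sM pE]]] := prime_in_square_coset M1 lM nsq.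
have redM d : (d %| M)%N -> (p = l * s ^ 2 %[mod d])%N.
  by move=> dM; move/(congr1 (modn^~ d)): pE; rewrite !modn_dvdm.
have [s2 [s3 sm]] : coprime 2 s /\ coprime 3 s /\ coprime m s.
  by move: sM; rewrite /M (_ : 24 = 2 * 2 * 2 * 3)%N // !coprimeMl => /andP[/andP[/andP[_ ->] ->] ->].
have s8 := coprime_odd_sqr_mod8 s2; have s3' := coprime3_sqr_mod3 s3.
have p3 : (p %% 3 = 1)%N by rewrite redM ?dvdn_mulr // -modnMm s3' muln1 modn_mod.
have p8 : (p %% 8 = t)%N by rewrite redM ?dvdn_mulr // -modnMm s8 muln1 modn_mod.
have p4 : (p %% 4 = 3)%N by case/orP: t37 p8 => /eqP ->; lia.
have p2 : (p %| 2)%N = false by apply/negP => /(dvdn_leq (isT : (0 < 2)%N)); clear -p4; lia.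
have mps : (m %| p + 2 * s ^ 2)%N.
  rewrite /dvdn -(modnDml p) (redM m) ?dvdn_mull // modnDml.
  rewrite -mulnDl lE (_ : _ * _ = m * (9 * m * (t + 2) * s ^ 2))%N ?modnMr //.
  by ring.
exists p, s; split=> //.
  rewrite prime_coprime //; apply/negP => pm.
  have : (p %| s)%N.
    by have := dvdn_trans pm mps; rewrite dvdn_addr ?dvdnn // Euclid_dvdM // p2 Euclid_dvdX // andbT.
  by apply/negP; rewrite -prime_coprime // (coprime_dvdl pm).
split=> //; apply: half_power_mult => // [q n qp qn|q qp qm].
  have : odd (q * n) by apply: dvdn_odd mo.
  by rewrite oddM => /andP[qo no]; rewrite mod8_signM.
have qo : odd q by apply: dvdn_odd mo.
have qs : ~~ (q %| s)%N by rewrite -prime_coprime // (coprime_dvdl qm).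
have pq : p != q.
  apply: contraNneq qs => pq; have := dvdn_trans qm mps.
  by rewrite -pq dvdn_addr ?dvdnn // Euclid_dvdM // p2 Euclid_dvdX // andbT.
by apply: (residue_of_prime_factor pp p4 qp qo qs pq).2; apply: dvdn_trans mps.
Qed.

Lemma exists_prime_two_square (m : nat) : odd m ->
  exists p s r, [/\ prime p, (p %% 3 = 1)%N, coprime p (2 * m), (m %| p + 2 * s ^ 2)%N &
    (r ^ 2 = 2 * m %[mod p])%N].
Proof.
(* The class of p modulo 8 is chosen so that (2/p) equals (2/m) = (m/p), hence (2m/p) = 1. *)
move=> mo; pose t := (if mod8_sign m then 3 else 7)%N.
have [|p [s [pp p3 p8 pm [mps mh]]]] := @exists_prime_minus_two_square m t mo; first by rewrite /t; case: ifP.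
have po : odd p by move: p8; rewrite /t; case: ifP => _; clear; lia.
have p4 : (p %% 4 = 3)%N by move: p8; rewrite /t; case: ifP => _; clear; lia.
have m2 : ((2 * m)%:R : 'F_p) ^+ (p.-1)./2 = 1.
  rewrite natrM exprMn mh (two_residue pp po) /mod8_sign p8 -/(mod8_sign m) /t.
  by case: (mod8_sign m); rewrite /= ?expr0 ?expr1 ?mulrNN ?mulr1.
have [r rE] := square_of_half_power pp p4 m2.
by exists p, s, r; split=> //; rewrite coprimeMr coprimen2 po.
Qed.

Lemma exists_prime_square (m : nat) : ((m %% 8 == 1) || (m %% 8 == 7))%N ->
  exists p s r, [/\ prime p, (p %% 3 = 1)%N, coprime p (2 * m), (m %| p + 2 * s ^ 2)%N &
    (r ^ 2 = m %[mod p])%N].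
Proof.
move=> m17; have mo : odd m by case/orP: m17 => /eqP; lia.
have [//|p [s [pp p3 p8 pm [mps mh]]]] := @exists_prime_minus_two_square m 7 mo.
have p4 : (p %% 4 = 3)%N by move: p8; clear; lia.
have po : odd p by move: p8; clear; lia.
have m1 : (m%:R : 'F_p) ^+ (p.-1)./2 = 1.
  by rewrite mh /mod8_sign; case/orP: m17 => /eqP ->.
have [r rE] := square_of_half_power pp p4 m1.
by exists p, s, r; split=> //; rewrite coprimeMr coprimen2 po.
Qed.

(** * Ternary forms *)

Open Scope Z_scope.

Lemma modn_eq_Z (m n d : nat) : (m = n %[mod d])%N ->
  exists k, Z.of_nat m = Z.of_nat n + k * Z.of_nat d.
Proof.
move=> h; exists (Z.of_nat (m %/ d) - Z.of_nat (n %/ d)).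
have := divn_eq m d; have := divn_eq n d; rewrite h; nia.
Qed.

Lemma dvdn_Z (d n : nat) : (d %| n)%N -> exists k, Z.of_nat n = k * Z.of_nat d.
Proof. by case/dvdnP => k ->; exists (Z.of_nat k); lia. Qed.

Lemma Z_of_natM (m n : nat) : Z.of_nat (m * n)%N = Z.of_nat m * Z.of_nat n.
Proof. lia. Qed.

Lemma Z_of_natD (m n : nat) : Z.of_nat (m + n)%N = Z.of_nat m + Z.of_nat n.
Proof. lia. Qed.

Lemma Z_of_nat_sqr (m : nat) : Z.of_nat (m ^ 2)%N = Z.of_nat m ^ 2.
Proof. lia. Qed.

Lemma coprime_divide_mul (m n : nat) (v : Z) : (0 < m)%N -> coprime m n ->
  (exists k, v = k * Z.of_nat m) -> (exists k, v = k * Z.of_nat n) ->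
  exists k, v = k * Z.of_nat (m * n).
Proof.
move=> m0 /(coprimeP _ m0)[[u1 u2] /= u] [k kE] [j jE].
have uE : Z.of_nat u1 * Z.of_nat m - Z.of_nat u2 * Z.of_nat n = 1 by nia.
exists (j * Z.of_nat u1 - k * Z.of_nat u2); rewrite -[LHS]Z.mul_1_r -{1}uE.
rewrite Nat2Z.inj_mul.
transitivity (Z.of_nat u1 * Z.of_nat m * v - Z.of_nat u2 * Z.of_nat n * v); first by ring.
rewrite {1}jE kE; ring.
Qed.

Lemma sqrt_box (n : nat) : exists k : nat, (k ^ 2 <= n < k.+1 ^ 2)%N.
Proof.
elim: n => [|n [k /andP[h1 h2]]]; first by exists 0%N.
have [h|h] := leqP (k.+1 ^ 2)%N n.+1; first by exists k.+1; lia.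
by exists k; lia.
Qed.

Lemma box_diff_sqr (s t r n : nat) : (s < r.+1)%N -> (t < r.+1)%N -> (r ^ 2 <= n)%N ->
  (Z.of_nat s - Z.of_nat t) ^ 2 <= Z.of_nat n.
Proof.
rewrite !ltnS => sr tr rn.
have d1 : Z.of_nat s - Z.of_nat t <= Z.of_nat r by lia.
have d2 : - Z.of_nat r <= Z.of_nat s - Z.of_nat t by lia.
have : Z.of_nat r ^ 2 <= Z.of_nat n by rewrite -Z_of_nat_sqr; lia.
move: (Z.of_nat s - Z.of_nat t) (Z.of_nat r) (Z.of_nat n) d1 d2; clear => d r' n'; nia.
Qed.

Lemma Z_divide_of_sqr (c u d : Z) : u ^ 2 = d * c ^ 2 -> exists w, u = w * c.
Proof.
move=> E; have : (Z.abs_nat c ^ 2 %| Z.abs_nat u ^ 2)%N.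
  apply/dvdnP; exists (Z.abs_nat d); apply: Nat2Z.inj.
  rewrite Z_of_natM !Z_of_nat_sqr !Zabs2Nat.id_abs.
  have u2 : Z.abs u ^ 2 = u ^ 2 by clear; lia.
  have c2 : Z.abs c ^ 2 = c ^ 2 by clear; lia.
  have d0 : 0 <= u ^ 2 by clear; nia.
  rewrite u2 c2 E; rewrite E in d0.
  have [->|c0] := Z.eq_dec c 0; first by rewrite !Z.mul_0_r.
  have : 0 < c ^ 2 by clear -c0; nia.
  by move: (c ^ 2) d0; clear => t; nia.
rewrite dvdn_pexp2r // => /dvdn_Z[k]; rewrite !Zabs2Nat.id_abs => uE.
by exists (k * Z.sgn u * Z.sgn c); clear -uE; nia.
Qed.

(* The value abc is traded for a zero by
   [a (xz+by)^2 + b (yz-ax)^2 = (a x^2 + b y^2) (z^2 + ab)]. *)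
Lemma ternary_zero_of_small_value (a b c x y z k : Z) :
    0 < a -> 0 < b -> 0 < c -> (forall t, t ^ 2 <> a * b) -> ~ (x = 0 /\ y = 0 /\ z = 0) ->
    x ^ 2 <= b * c -> y ^ 2 <= a * c -> z ^ 2 <= a * b ->
    a * x ^ 2 + b * y ^ 2 - c * z ^ 2 = k * (a * b * c) ->
  exists x y z, z <> 0 /\ a * x ^ 2 + b * y ^ 2 = c * z ^ 2.
Proof.
move=> a0 b0 c0 nsq nz x2le y2le z2le VE.
(* The box bounds leave k from -1 to 2. At k = -1 one has z^2 = ab; at k = 2 one has x^2 = bc and
   y^2 = ac, so (xy/c)^2 = ab. Both contradict that ab is not a square. *)
have Vk : k = 0 \/ k = 1.
  have h1 : a * x ^ 2 <= a * b * c by nia.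
  have h2 : b * y ^ 2 <= a * b * c by nia.
  have h3 : c * z ^ 2 <= a * b * c by nia.
  have abc0 : 0 < a * b * c by nia.
  have k2 : k <= 2 by nia.
  have k1 : -1 <= k by nia.
  have km1 : k <> -1.
    move=> kE; rewrite kE in VE; have x0 : a * x ^ 2 = 0 by nia.
    have y0 : b * y ^ 2 = 0 by nia.
    by apply: (nsq z); nia.
  have kp2 : k <> 2.
    move=> kE; rewrite kE in VE.
    have x0 : x ^ 2 = b * c by nia.
    have y0 : y ^ 2 = a * c by nia.
    have [w wE] : (c | x * y).
      apply: (@Z_divide_of_sqr _ _ (a * b)).
      by rewrite Z.pow_mul_l x0 y0; ring.
    apply: (nsq w); have : (x * y) ^ 2 = (a * b) * c ^ 2 by rewrite Z.pow_mul_l x0 y0; ring.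
    by rewrite wE Z.pow_mul_l => /Z.mul_cancel_r; apply; nia.
  lia.
have [x' [y' [z' [nz' vE]]]] : exists x y z, ~ (x = 0 /\ y = 0 /\ z = 0) /\
    a * x ^ 2 + b * y ^ 2 = c * z ^ 2.
  case: Vk => kE; rewrite kE in VE; first by exists x, y, z; split=> //; lia.
  exists (x * z + b * y), (y * z - a * x), (z ^ 2 + a * b).
  split; first by nia.
  have -> : c * (z ^ 2 + a * b) ^ 2 =
    (a * x ^ 2 + b * y ^ 2) * (z ^ 2 + a * b).
    have -> : a * x ^ 2 + b * y ^ 2 = c * (z ^ 2 + a * b).
      by lia.
    ring.
  ring.
exists x', y', z'; split=> // z0; apply: nz'; rewrite z0 in vE *; clear -a0 b0 vE.
have [hx hy] : 0 <= x' ^ 2 /\ 0 <= y' ^ 2 by split; nia.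
have [hx' hy'] : x' ^ 2 = 0 /\ y' ^ 2 = 0.
  by move: (x' ^ 2) (y' ^ 2) hx hy vE => X Y; split; nia.
by split; [nia | split; nia].
Qed.

(* Pigeonhole on a box with sides just above sqrt(bc), sqrt(ac), sqrt(ab) gives a value of the form
   in [-abc, 2abc] divisible by abc. *)
Lemma legendre_ternary (a b c A B C : nat) :
    (0 < a)%N -> (0 < b)%N -> (0 < c)%N ->
    coprime a b -> coprime a c -> coprime b c ->
    (forall k, (k ^ 2 != a * b)%N) ->
    (c * A ^ 2 = b %[mod a])%N -> (a * B ^ 2 = c %[mod b])%N -> (c %| b + a * C ^ 2)%N ->
  exists x y z : Z, z <> 0 /\
    Z.of_nat a * x ^ 2 + Z.of_nat b * y ^ 2 = Z.of_nat c * z ^ 2.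
Proof.
move=> a0 b0 c0 ab ac bc nsq hA hB hC.
have [X /andP[X1 X2]] := sqrt_box (b * c).
have [Y /andP[Y1 Y2]] := sqrt_box (a * c).
have [W /andP[W1 W2]] := sqrt_box (a * b).
(* A collision gives differences with z = -Ay mod a, x = -Bz mod b and x = -Cy mod c. Each
   congruence, with the matching hypothesis, makes the form vanish for that modulus. *)
pose f (u : 'I_X.+1 * 'I_Y.+1 * 'I_W.+1) : 'I_a * 'I_b * 'I_c :=
  (Ordinal (ltn_pmod (u.2 + A * u.1.2) a0), Ordinal (ltn_pmod (u.1.1 + B * u.2) b0),
   Ordinal (ltn_pmod (u.1.1 + C * u.1.2) c0)).
have [[[x1 y1] z1] [[[x2 y2] z2] [uv]]] : exists u v, u <> v /\ f u = f v.
  have : ~~ injectiveb f.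
    apply/negP => /injectiveP /leq_card; rewrite !card_prod !card_ord => le.
    have : ((X.+1 * Y.+1 * W.+1) ^ 2 <= (a * b * c) ^ 2)%N by rewrite leq_exp2r.
    have : ((a * b * c) ^ 2 = (b * c) * (a * c) * (a * b))%N by ring.
    have h1 := leq_mul (leq_mul X2 Y2) W2.
    rewrite !expnMn => -> h2; have := leq_trans h1 h2.
    by rewrite leqNgt !ltn_mul.
  case/injectivePn => u [v /eqP uv fE]; by exists u, v.
rewrite /f /= => -[/modn_eq_Z[k1 e1] /modn_eq_Z[k2 e2] /modn_eq_Z[k3 e3]].
have {uv} uv : ~ (Z.of_nat x1 = Z.of_nat x2 /\ Z.of_nat y1 = Z.of_nat y2 /\ Z.of_nat z1 = Z.of_nat z2).
  by move=> [/Nat2Z.inj/val_inj h1 [/Nat2Z.inj/val_inj h2 /Nat2Z.inj/val_inj h3]]; apply: uv; rewrite h1 h2 h3.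
have [bx1 bx2] := (ltn_ord x1, ltn_ord x2).
have [by1 by2] := (ltn_ord y1, ltn_ord y2).
have [bz1 bz2] := (ltn_ord z1, ltn_ord z2).
move: {f} (nat_of_ord x1) (nat_of_ord x2) (nat_of_ord y1) (nat_of_ord y2) (nat_of_ord z1)
  (nat_of_ord z2) e1 e2 e3 uv bx1 bx2 by1 by2 bz1 bz2 => {x1 x2 y1 y2 z1 z2}.
move=> x1 x2 y1 y2 z1 z2 e1 e2 e3 uv bx1 bx2 by1 by2 bz1 bz2.
pose x := Z.of_nat x1 - Z.of_nat x2; pose y := Z.of_nat y1 - Z.of_nat y2.
pose z := Z.of_nat z1 - Z.of_nat z2.
pose V := Z.of_nat a * x ^ 2 + Z.of_nat b * y ^ 2 - Z.of_nat c * z ^ 2.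
have [jA {}hA] := modn_eq_Z hA; have [jB {}hB] := modn_eq_Z hB.
have [jC {}hC] := dvdn_Z hC.
rewrite !(Z_of_natM, Z_of_natD, Z_of_nat_sqr) in hA hB hC.
have Va : exists k, V = k * Z.of_nat a.
  have zE : z = k1 * Z.of_nat a - Z.of_nat A * y by rewrite /z /y; clear -e1; lia.
    exists (x ^ 2 - Z.of_nat c * (k1 ^ 2 * Z.of_nat a - 2 * k1 * Z.of_nat A * y) - jA * y ^ 2).
  rewrite /V zE.
  transitivity (Z.of_nat a * x ^ 2 + Z.of_nat b * y ^ 2 - (Z.of_nat c * Z.of_nat A ^ 2) * y ^ 2
    - Z.of_nat c * (k1 ^ 2 * Z.of_nat a - 2 * k1 * Z.of_nat A * y) * Z.of_nat a); first by ring.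
  rewrite hA; ring.
have Vb : exists k, V = k * Z.of_nat b.
  have xE : x = k2 * Z.of_nat b - Z.of_nat B * z by rewrite /x /z; clear -e2; lia.
    exists (y ^ 2 + Z.of_nat a * (k2 ^ 2 * Z.of_nat b - 2 * k2 * Z.of_nat B * z) + jB * z ^ 2).
  rewrite /V xE.
  transitivity ((Z.of_nat a * Z.of_nat B ^ 2) * z ^ 2 + Z.of_nat b * y ^ 2 - Z.of_nat c * z ^ 2
    + Z.of_nat a * (k2 ^ 2 * Z.of_nat b - 2 * k2 * Z.of_nat B * z) * Z.of_nat b); first by ring.
  rewrite hB; ring.
have Vc : exists k, V = k * Z.of_nat c.
  have xE : x = k3 * Z.of_nat c - Z.of_nat C * y by rewrite /x /y; clear -e3; lia.
  exists (jC * y ^ 2 + Z.of_nat a * (k3 ^ 2 * Z.of_nat c - 2 * k3 * Z.of_nat C * y) - z ^ 2).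
  rewrite /V xE.
  transitivity ((Z.of_nat b + Z.of_nat a * Z.of_nat C ^ 2) * y ^ 2 - Z.of_nat c * z ^ 2
    + Z.of_nat a * (k3 ^ 2 * Z.of_nat c - 2 * k3 * Z.of_nat C * y) * Z.of_nat c); first by ring.
  rewrite hC; ring.
have abc : coprime (a * b) c by rewrite coprimeMl ac bc.
have ab0 : (0 < a * b)%N by rewrite muln_gt0 a0.
have [k VE] := coprime_divide_mul ab0 abc (coprime_divide_mul a0 ab Va Vb) Vc.
have x2le := box_diff_sqr bx1 bx2 X1; have y2le := box_diff_sqr by1 by2 Y1.
have z2le := box_diff_sqr bz1 bz2 W1.
rewrite -/x -/y -/z !Z_of_natM in x2le y2le z2le VE.
have nsqZ t : t ^ 2 <> Z.of_nat a * Z.of_nat b.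
  move=> tE; have := nsq (Z.abs_nat t); move/eqP; apply; apply: Nat2Z.inj.
  by rewrite Z_of_nat_sqr Z_of_natM -tE; clear -t; lia.
have nz : ~ (x = 0 /\ y = 0 /\ z = 0).
  by move=> [h1 [h2 h3]]; apply: uv; rewrite /x /y /z in h1 h2 h3; clear -h1 h2 h3; lia.
have [{}a0 [{}b0 {}c0]] : 0 < Z.of_nat a /\ 0 < Z.of_nat b /\ 0 < Z.of_nat c.
  by move: a0 b0 c0; clear; lia.
exact: (ternary_zero_of_small_value a0 b0 c0 nsqZ nz x2le y2le z2le VE).
Qed.

(** * Primes 1 mod 3 as values of N *)

Definition eis (z w : Z) := z ^ 2 + z * w + w ^ 2.

Lemma cube_root_mod_prime (p : nat) : prime p -> (p %% 3 = 1)%N ->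
  exists r, (p %| r ^ 2 + r + 1)%N.
Proof.
move=> pp p3; have d3 : (3 %| #|[set: {unit 'F_p}]|)%N.
  by rewrite card_finField_unit card_Fp //; lia.
have [x _ x3] := Cauchy (isT : prime 3) d3.
have x1 : x != 1%g by rewrite -order_eq1 x3.
have [r rE] : exists r : nat, val x = (r%:R)%R by exists (val x : nat); rewrite natr_Zp.
exists r; rewrite (dvdn_pcharf (pchar_Fp pp)) !natrD natrX -rE.
have : (val x ^+ 3 = 1 :> 'F_p)%R by rewrite -FinRing.val_unitX -x3 expg_order.
have x1' : (val x - 1 != 0 :> 'F_p)%R.
  by rewrite subr_eq0; apply: contra x1 => /eqP h; apply/eqP/val_inj.
move=> h; apply/eqP/(mulfI x1'); rewrite mulr0.
rewrite (_ : _ * _ = val x ^+ 3 - 1)%R; last by ring.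
by rewrite h subrr.
Qed.

(** Thue's argument: pigeonhole gives x = -ry mod p with x^2, y^2 < p, so x^2 - xy + y^2 = qp with 0
    < q < 3. For q = 2 one gets (2x-y)^2 = 8p - 3y^2 = 2 mod 3, which is impossible. *)
Lemma prime_norm_form (p : nat) : prime p -> (p %% 3 = 1)%N -> exists u v, Z.of_nat p = eis u v.
Proof.
move=> pp p3; have [r /dvdn_Z[j rE]] := cube_root_mod_prime pp p3.
have p0 := prime_gt0 pp; have [X /andP[X1 X2]] := sqrt_box p.
pose f (u : 'I_X.+1 * 'I_X.+1) : 'I_p := Ordinal (ltn_pmod (u.1 + r * u.2) p0).
have [[x1 y1] [[x2 y2] [uv]]] : exists u v, u <> v /\ f u = f v.
  have : ~~ injectiveb f.
    by apply/negP => /injectiveP /leq_card; rewrite card_prod !card_ord; lia.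
  case/injectivePn => u [v /eqP uv fE]; by exists u, v.
rewrite /f /= => -[/modn_eq_Z[k e]].
have x2le := box_diff_sqr (ltn_ord x1) (ltn_ord x2) X1.
have y2le := box_diff_sqr (ltn_ord y1) (ltn_ord y2) X1.
have {}uv : ~ (Z.of_nat x1 - Z.of_nat x2 = 0 /\ Z.of_nat y1 - Z.of_nat y2 = 0).
  move=> [h1 h2]; apply: uv; congr (_, _); apply: val_inj; apply: Nat2Z.inj => /=.
    by clear -h1; lia.
  by clear -h2; lia.
rewrite !(Z_of_natM, Z_of_natD, Z_of_nat_sqr) in e rE.
have {f} xE : Z.of_nat x1 - Z.of_nat x2 =
    k * Z.of_nat p - Z.of_nat r * (Z.of_nat y1 - Z.of_nat y2) by clear -e; lia.
move: (Z.of_nat x1 - Z.of_nat x2) (Z.of_nat y1 - Z.of_nat y2) x2le y2le uv xE => x y.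
move=> x2le y2le uv xE.
have nsq t : t ^ 2 <> Z.of_nat p.
  move=> tE; have := prime_gt1 pp; have : (Z.abs_nat t ^ 2 = p)%N.
    by apply: Nat2Z.inj; rewrite Z_of_nat_sqr -tE; clear; lia.
  move=> pE p1; move: pp; rewrite -pE expnS expn1 => h.
  have := primeP h; case=> _ /(_ (Z.abs_nat t) (dvdn_mulr _ (dvdnn _))) /orP[] /eqP; clear -p1 pE; nia.
have x2lt : x ^ 2 < Z.of_nat p by have := nsq x; clear -x2le; lia.
have y2lt : y ^ 2 < Z.of_nat p by have := nsq y; clear -y2le; lia.
have VE : x ^ 2 - x * y + y ^ 2 =
    Z.of_nat p * (k ^ 2 * Z.of_nat p - 2 * k * Z.of_nat r * y - k * y + j * y ^ 2).
  have -> : x ^ 2 - x * y + y ^ 2 = Z.of_nat p * (k ^ 2 * Z.of_nat p - 2 * k * Z.of_nat r * y - k * y)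
    + (Z.of_nat r ^ 2 + Z.of_nat r + 1) * y ^ 2 by rewrite xE; ring.
  by rewrite rE; ring.
have {rE xE} := VE; move: (_ - _ + _ * _) => q {}VE.
have P0 : 0 < Z.of_nat p by clear -p0; lia.
have q1 : 0 < q by clear -VE uv P0; nia.
have q3 : q < 3.
  have : 2 * (x ^ 2 - x * y + y ^ 2) <= 3 * x ^ 2 + 3 * y ^ 2 by clear; have := Z.square_nonneg (x + y); lia.
  by rewrite VE; clear -x2lt y2lt P0; nia.
have q2 : q <> 2.
  move=> qE; rewrite qE in VE.
  have [u uE] : exists u, Z.of_nat p = 3 * u + 1 by exists (Z.of_nat (p %/ 3)); clear -p3; lia.
  have sE : (2 * x - y) ^ 2 = 3 * (8 * u + 2 - y ^ 2) + 2 by clear -VE uE; lia.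
  have [v [r' [vE r'E]]] : exists v r', 2 * x - y = 3 * v + r' /\ (r' = 0 \/ r' = 1 \/ r' = 2).
    exists ((2 * x - y) / 3), ((2 * x - y) mod 3); clear.
    have := Z.div_mod (2 * x - y) 3; have := Z.mod_pos_bound (2 * x - y) 3; lia.
  by rewrite vE in sE; case: r'E => [|[|]] r'E; rewrite r'E in sE; clear -sE; lia.
exists x, (- y); rewrite /eis; have qE : q = 1 by lia.
by rewrite qE in VE; clear -VE; lia.
Qed.

(** * Descent from rational to integral representations *)

Lemma round_quotient x t : 0 < t -> exists q r, x = t * q + r /\ - t <= 2 * r <= t.
Proof.
move=> t0; exists ((2 * x + t) / (2 * t)), (x - t * ((2 * x + t) / (2 * t))).
have := Z.div_mod (2 * x + t) (2 * t); have := Z.mod_pos_bound (2 * x + t) (2 * t).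
lia.
Qed.

(* The second intersection of the quadric [a x^2 + eis y z = m] with the line through the rational point
   [(x, y, z)/t] and a nearest lattice point has smaller denominator; rounding achieves [F < t^2] for [a <= 2]. *)
Lemma aubry_step (a m t x y z : Z) : 0 < a <= 2 -> 1 < t -> m * t ^ 2 = a * x ^ 2 + eis y z ->
  (exists x y z, m = a * x ^ 2 + eis y z) \/
  exists t', 0 < t' < t /\ exists x y z, m * t' ^ 2 = a * x ^ 2 + eis y z.
Proof.
move=> a12 t1 E; have t0 : 0 < t by lia.
have [q0 [r0 [xE h0]]] := round_quotient x t0.
have [q2 [r2 [zE h2]]] := round_quotient z t0.
(* Here 2 r1 + r2 is rounded instead of r1, because 4 [eis r1 r2] = (2 r1 + r2)^2 + 3 r2^2. Then 4F
   <= (2 + 1 + 3/4) t^2, whereas coordinatewise rounding only bounds F by 5/4 t^2 when a = 2. *)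
have [q1 [s1 [yE h1]]] := @round_quotient (2 * y + r2) (2 * t) ltac:(lia).
pose r1 := y - t * q1.
have y'E : y = t * q1 + r1 by rewrite /r1; lia.
have {yE} s1E : s1 = 2 * r1 + r2 by rewrite /r1; lia.
pose Q := a * q0 ^ 2 + eis q1 q2; pose F := a * r0 ^ 2 + eis r1 r2.
pose B := 2 * a * x * q0 + 2 * y * q1 + y * q2 + z * q1 + 2 * z * q2.
pose t' := m * t - B + t * Q.
have FE : F = t * t'.
  have -> : t * t' = m * t ^ 2 - t * B + t ^ 2 * Q by rewrite /t'; ring.
  rewrite E /B /Q /F /eis xE y'E zE; ring.
have F0 : 0 <= F by rewrite /F /eis; clear -a12; nia.
have Ft : F < t ^ 2.
  have : 4 * F = 4 * a * r0 ^ 2 + s1 ^ 2 + 3 * r2 ^ 2 by rewrite /F /eis s1E; ring.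
  have : 4 * r0 ^ 2 <= t ^ 2 by clear -h0; nia.
  have : 4 * r2 ^ 2 <= t ^ 2 by clear -h2; nia.
  have : s1 ^ 2 <= t ^ 2 by clear -h1; nia.
  clear -a12 t0; nia.
have [F00|F00] := Z.eq_dec F 0.
  left; exists q0, q1, q2.
  have r00 : r0 = 0 by clear -F00 a12; rewrite /F /eis in F00; nia.
  have r10 : r1 = 0 by clear -F00 a12; rewrite /F /eis in F00; nia.
  have r20 : r2 = 0 by clear -F00 a12; rewrite /F /eis in F00; nia.
  have : m * t ^ 2 = (a * q0 ^ 2 + eis q1 q2) * t ^ 2.
    rewrite E xE y'E zE r00 r10 r20 /eis; ring.
  by move/Z.mul_cancel_r; apply; clear -t0; nia.
right; exists t'; split; first by clear -FE F00 F0 Ft t0; nia.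
exists (t' * q0 + (Q - m) * r0), (t' * q1 + (Q - m) * r1), (t' * q2 + (Q - m) * r2).
have BE : 2 * a * q0 * r0 + 2 * q1 * r1 + q1 * r2 + q2 * r1 + 2 * q2 * r2 = m * t - t * Q - t'.
  rewrite /t' /B /Q /eis xE y'E zE; ring.
transitivity (t' ^ 2 * Q + t' * (Q - m) * (2 * a * q0 * r0 + 2 * q1 * r1 + q1 * r2 + q2 * r1 + 2 * q2 * r2)
  + (Q - m) ^ 2 * F); last by rewrite /Q /F /eis; ring.
rewrite BE FE; ring.
Qed.

Lemma aubry (a m t x y z : Z) : 0 < a <= 2 -> t <> 0 -> m * t ^ 2 = a * x ^ 2 + eis y z ->
  exists x y z, m = a * x ^ 2 + eis y z.
Proof.
move=> a12 t0 E; have [k kE] : exists k, Z.abs t = Z.of_nat k by exists (Z.abs_nat t); lia.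
have k0 : (0 < k)%N by lia.
have {}E : m * Z.of_nat k ^ 2 = a * x ^ 2 + eis y z by rewrite -kE -E; lia.
elim/ltn_ind: k => k IH in k0 x y z E {kE} *.
have [k1|k1] := leqP k 1.
  by exists x, y, z; rewrite -E (_ : k = 1%N); lia.
have k1' : 1 < Z.of_nat k by lia.
have [//|[t' [t'k [x' [y' [z' E']]]]]] := aubry_step a12 k1' E.
by apply: (IH (Z.to_nat t') _ _ x' y' z'); rewrite ?Z2Nat.id //; lia.
Qed.

(** * Integers represented by the three ternary forms *)

Lemma odd_logn_nonsquare (p n k : nat) : odd (logn p n) -> (k ^ 2 != n)%N.
Proof. by apply: contraTneq => <-; rewrite lognX oddM. Qed.

Lemma odd_logn_double (p : nat) : prime p -> odd p -> odd (logn p (2 * p)).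
Proof.
move=> pp po; rewrite lognM ?prime_gt0 // logn_prime // (logn_prime _ pp) eqxx.
by case: eqP => // p2; rewrite p2 in po.
Qed.

Lemma eis_scale (y u v : Z) : y ^ 2 * eis u v = eis (y * u) (y * v).
Proof. rewrite /eis; ring. Qed.

Lemma Z_residue (x d : Z) : 0 < d -> exists q r, x = d * q + r /\ 0 <= r < d.
Proof.
move=> d0; exists (x / d), (x mod d).
by have := Z.div_mod x d; have := Z.mod_pos_bound x d; lia.
Qed.

Lemma eis_even (k u v : Z) : eis u v = 2 * k -> exists u' v', u = 2 * u' /\ v = 2 * v'.
Proof.
move=> E; have [a [e [uE eE]]] := Z_residue u Z.lt_0_2.
have [b [f [vE fE]]] := Z_residue v Z.lt_0_2.
have {}eE : e = 0 \/ e = 1 by clear -eE; lia.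
have {}fE : f = 0 \/ f = 1 by clear -fE; lia.
exists a, b; rewrite uE vE /eis in E *; clear uE vE.
by case: eE fE E => -> [] -> E; clear -E; lia.
Qed.

Lemma sqr_add_norm (m k : Z) : 0 < m -> m = 3 * k + 1 \/ m = 3 * k + 2 ->
  exists x z w, m = x ^ 2 + eis z w.
Proof.
move=> m0 m3; have [n mE] : exists n : nat, m = Z.of_nat n by exists (Z.to_nat m); lia.
rewrite mE in m0 m3 *; have n0 : (0 < n)%N by lia.
have n3 : ~~ (3 %| n)%N by lia.
have [p [s [r [pp p3 pm nps rE]]]] := exists_prime_minus_square n0 n3.
have nsq t : (t ^ 2 != 1 * p)%N.
  by apply: (@odd_logn_nonsquare p); rewrite mul1n logn_prime // eqxx.
have [||//|x [y [z [z0 E]]]] := @legendre_ternary 1 p n 0 r s isT (prime_gt0 pp) n0 (coprime1n _) (coprime1n _) pm nsq.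
- by rewrite !modn1.
- by rewrite mul1n rE.
- by rewrite mul1n.
have [u [v pE]] := prime_norm_form pp p3.
have {}E : Z.of_nat n * z ^ 2 = 1 * x ^ 2 + eis (y * u) (y * v).
  by rewrite -eis_scale -pE -E; clear; lia.
have [x' [y' [z' ->]]] := aubry (conj Z.lt_0_1 (ltac:(lia) : 1 <= 2)) z0 E.
by exists x', y', z'; clear; lia.
Qed.

Lemma two_sqr_add_norm (m k : Z) : 0 < m -> m = 2 * k + 1 -> exists x z w, m = 2 * x ^ 2 + eis z w.
Proof.
move=> m0 m2; have [n mE] : exists n : nat, m = Z.of_nat n by exists (Z.to_nat m); lia.
rewrite mE in m0 m2 *; have n0 : (0 < n)%N by lia.
have no : odd n by lia.
have [p [s [r [pp p3 + nps rE]]]] := exists_prime_two_square no.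
rewrite coprimeMr coprimen2 => /andP[po pm].
(* [h] inverts 2 modulo p, so r^2 = 2n turns into 2 (rh)^2 = n. *)
pose h := (p.+1)./2; have hE : (2 * h = p + 1)%N by rewrite /h; clear -po; lia.
have hB : (2 * (r * h) ^ 2 = n %[mod p])%N.
  rewrite (_ : 2 * (r * h) ^ 2 = 2 * h ^ 2 * r ^ 2)%N; last by ring.
  rewrite -modnMmr rE modnMmr (_ : 2 * h ^ 2 * (2 * n) = (2 * h) ^ 2 * n)%N; last by ring.
  by rewrite hE (_ : (p + 1) ^ 2 * n = (p + 2) * n * p + n)%N ?modnMDl //; ring.
have nsq t : (t ^ 2 != 2 * p)%N by apply: odd_logn_nonsquare (odd_logn_double pp po).
have hA : (n * 1 ^ 2 = p %[mod 2])%N by rewrite muln1 !modn2 po no.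
have c2p : coprime 2 p by rewrite coprime2n.
have c2n : coprime 2 n by rewrite coprime2n.
have [x [y [z [z0 E]]]] := legendre_ternary (isT : (0 < 2)%N) (prime_gt0 pp) n0 c2p c2n pm nsq hA hB nps.
have [u [v pE]] := prime_norm_form pp p3.
have {}E : Z.of_nat n * z ^ 2 = 2 * x ^ 2 + eis (y * u) (y * v).
  by rewrite -eis_scale -pE -E; clear; lia.
by have [x' [y' [z' ->]]] := aubry (conj Z.lt_0_2 (Z.le_refl 2)) z0 E; exists x', y', z'.
Qed.

Lemma halve_two_sqr_add_norm (m x z w : Z) : 2 * m = 2 * x ^ 2 + eis z w ->
  exists x z w, m = x ^ 2 + 2 * eis z w.
Proof.
move=> E; have [z' [w' [zE wE]]] : exists z' w', z = 2 * z' /\ w = 2 * w'.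
  by apply: (@eis_even (m - x ^ 2)); rewrite Z.mul_sub_distr_l E; clear; lia.
by exists x, z', w'; rewrite zE wE /eis in E *; clear -E; lia.
Qed.

(** For m = 2 mod 4, double a representation of m/2 by 2x^2 + N. Otherwise solve x^2 + 2p y^2 = m
    z^2 and double it, so that the descent applies to 2m and the form 2x^2 + N. *)
Lemma sqr_add_two_norm (m k : Z) : 0 < m -> [\/ m = 8 * k + 1, m = 8 * k + 7 | m = 4 * k + 2] ->
  exists x z w, m = x ^ 2 + 2 * eis z w.
Proof.
move=> m0 mk; have [E|m17] : m = 4 * k + 2 \/ (m = 8 * k + 1 \/ m = 8 * k + 7).
- by case: mk; auto.
- have [||x [z [w mE]]] := @two_sqr_add_norm (2 * k + 1) k; [lia | by [] |].
  exists (2 * x), z, w; rewrite E.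
  by clear -mE; lia.
have [n mE] : exists n : nat, m = Z.of_nat n by exists (Z.to_nat m); lia.
rewrite mE in m0 m17 *; have n0 : (0 < n)%N by lia.
have n17 : ((n %% 8 == 1) || (n %% 8 == 7))%N by clear -m17; lia.
have no : odd n by clear -n17; lia.
have [p [s [r [pp p3 + nps rE]]]] := exists_prime_square n17.
rewrite coprimeMr coprimen2 => /andP[po pm].
have c2p : coprime 2 p by rewrite coprime2n.
have [B hB] : exists B, (1 * B ^ 2 = n %[mod 2 * p])%N.
  (* Adding the odd p corrects the parity of r without changing it modulo p. *)
  exists (if odd r then r else r + p)%N; apply/eqP; rewrite mul1n chinese_remainder //.
  rewrite !modn2 oddX /=; have -> : odd (if odd r then r else r + p)%N.
    by case: ifP => //; rewrite oddD po => ->.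
  rewrite no eqxx /=; case: (odd r); first by rewrite rE.
  by rewrite -modnXm modnDr modnXm rE.
have nsq t : (t ^ 2 != 1 * (2 * p))%N.
  by rewrite mul1n; apply: odd_logn_nonsquare (odd_logn_double pp po).
have hA : (n * 0 ^ 2 = 2 * p %[mod 1])%N by rewrite !modn1.
have hC : (n %| 2 * p + 1 * (2 * s) ^ 2)%N.
  by rewrite (_ : _ + _ = 2 * (p + 2 * s ^ 2))%N ?dvdn_mull //; ring.
have p20 : (0 < 2 * p)%N by rewrite muln_gt0 (prime_gt0 pp).
have c2pn : coprime (2 * p) n by rewrite coprimeMl coprime2n no pm.
have [x [y [z [z0 E]]]] := legendre_ternary (isT : (0 < 1)%N) p20 n0 (coprime1n _) (coprime1n _) c2pn nsq hA hB hC.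
have [u [v pE]] := prime_norm_form pp p3.
have {}E : (2 * Z.of_nat n) * z ^ 2 = 2 * x ^ 2 + eis (2 * y * u) (2 * y * v).
  by rewrite -eis_scale -pE; move: E; rewrite Z_of_natM; clear; lia.
have [x' [y' [z' E']]] := aubry (conj Z.lt_0_2 (Z.le_refl 2)) z0 E.
exact: halve_two_sqr_add_norm E'.
Qed.

(** * Quaternary forms *)

(** One of z, w and z + w is even, and the symmetries of N move it to the second argument, where
    completing the square is integral. *)
Lemma eis_diagonal z w : exists u v, eis z w = u ^ 2 + 3 * v ^ 2.
Proof.
have even z' v : exists u w', eis z' (2 * v) = u ^ 2 + 3 * w' ^ 2.
  by exists (z' + v), v; rewrite /eis; ring.
have [p [e [zE eE]]] := Z_residue z Z.lt_0_2; have [q [f [wE fE]]] := Z_residue w Z.lt_0_2.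
have [w2|[z2|zw2]] : w = 2 * q \/ z = 2 * p \/ z + w = 2 * (p + q + 1) by clear -zE eE wE fE; lia.
- by rewrite w2.
- by have -> : eis z w = eis w z by [rewrite /eis; ring]; rewrite z2.
by have -> : eis z w = eis (- z) (z + w) by [rewrite /eis; ring]; rewrite zw2.
Qed.

Definition range (k : nat) : list Z := List.map Z.of_nat (List.seq 0 k).

(** The ranges suffice for every use below, the largest being all n < 129 for the triple (1, 2,
    3). *)
Definition searches (a b c n : Z) : bool :=
  List.existsb (fun x => List.existsb (fun y => List.existsb (fun z => List.existsb (fun w =>
    Z.eqb n (f_abc a b c x y z w)) (range 9)) (range 12)) (range 12)) (range 12).

Lemma represents_below (a b c n : Z) (k : nat) :
  List.forallb (searches a b c) (range k) = true -> 0 <= n < Z.of_nat k -> represents a b c n.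
Proof.
move=> /List.forallb_forall h nk.
have {h} /List.existsb_exists[x [_ /List.existsb_exists[y [_ /List.existsb_exists[z [_ /List.existsb_exists[w [_]]]]]]]] :
    searches a b c n = true.
  by apply: h; apply/List.in_map_iff; exists (Z.to_nat n); rewrite List.in_seq; lia.
by move/Z.eqb_eq => h; exists x, y, z, w.
Qed.

Lemma represents_zero a b c : represents a b c 0.
Proof. by exists 0, 0, 0, 0; rewrite /f_abc; ring. Qed.

Lemma represents_mul4 a b c n : represents a b c n -> represents a b c (4 * n).
Proof.
by move=> [x [y [z [w ->]]]]; exists (2 * x), (2 * y), (2 * z), (2 * w); rewrite /f_abc; ring.
Qed.

Lemma represents_1b1 (b y m k : Z) : 0 < m -> m = 3 * k + 1 \/ m = 3 * k + 2 ->
  represents 1 b 1 (m + b * y ^ 2).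
Proof.
by move=> m0 /(sqr_add_norm m0)[x [z [w ->]]]; exists x, y, z, w; rewrite /f_abc /eis; ring.
Qed.

Lemma represents_2b1 (b y m k : Z) : 0 < m -> m = 2 * k + 1 -> represents 2 b 1 (m + b * y ^ 2).
Proof.
by move=> m0 /(two_sqr_add_norm m0)[x [z [w ->]]]; exists x, y, z, w; rewrite /f_abc /eis; ring.
Qed.

Lemma represents_1b2 (b y m k : Z) : 0 < m ->
  m = 8 * k + 1 \/ m = 8 * k + 7 \/ m = 4 * k + 2 -> represents 1 b 2 (m + b * y ^ 2).
Proof.
move=> m0 mk; have [x [z [w ->]]] : exists x z w, m = x ^ 2 + 2 * eis z w.
  by apply: (@sqr_add_two_norm m k m0); case: mk => [|[|]] h; [constructor 1 | constructor 2 | constructor 3].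
by exists x, y, z, w; rewrite /f_abc /eis; ring.
Qed.

Lemma universal_1b1_prime_to_3 b : b = 1 \/ b = 2 \/ b = 4 \/ b = 5 -> universal 1 b 1.
Proof.
move=> bE n n0; have [q [r [nE r3]]] := @Z_residue n 3 ltac:(lia).
have [nb|nb] := Z_lt_le_dec n 6.
  by apply: (@represents_below _ _ _ _ 6) => //; case: bE => [|[|[|]]] ->; vm_compute.
have [r0|r0] := Z.eq_dec r 0; last first.
  by rewrite -(Z.add_0_r n) -(Z.mul_0_r b); apply: (@represents_1b1 b 0 n q); lia.
have -> : n = (n - b) + b * 1 ^ 2 by ring.
have [k kE] : exists k, n - b = 3 * k + 1 \/ n - b = 3 * k + 2.
  by case: bE => [|[|[|]]] bE; [exists (q - 1) | exists (q - 1) | exists (q - 2) | exists (q - 2)]; lia.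
by apply: (@represents_1b1 b 1 _ k) => //; lia.
Qed.

Lemma universal_2b1_odd b : b = 3 \/ b = 5 \/ b = 7 \/ b = 9 -> universal 2 b 1.
Proof.
move=> bE n n0; have [q [r [nE r2]]] := Z_residue n Z.lt_0_2.
have [nb|nb] := Z_lt_le_dec n 10.
  by apply: (@represents_below _ _ _ _ 10) => //; case: bE => [|[|[|]]] ->; vm_compute.
have [r0|r0] := Z.eq_dec r 0; last first.
  by rewrite -(Z.add_0_r n) -(Z.mul_0_r b); apply: (@represents_2b1 b 0 n q); lia.
have -> : n = (n - b) + b * 1 ^ 2 by ring.
have [k kE] : exists k, n - b = 2 * k + 1.
  by case: bE => [|[|[|]]] bE; [exists (q - 2) | exists (q - 3) | exists (q - 4) | exists (q - 5)]; lia.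
by apply: (@represents_2b1 b 1 _ k) => //; lia.
Qed.

Lemma universal_131 : universal 1 3 1.
Proof.
apply: Zlt_0_ind => n IH n0; have [q [r [nE r3]]] := @Z_residue n 3 ltac:(lia).
have [r0|r0] := Z.eq_dec r 0; last first.
  by rewrite -(Z.add_0_r n) -(Z.mul_0_r 3); apply: (@represents_1b1 3 0 n q); lia.
have [->|n1] := Z.eq_dec n 0; first exact: represents_zero.
have [x [y [z [w qE]]]] := IH q ltac:(lia).
(* N(z - w, z + 2w) = 3 N(z, w), so three times this form is again a value of it. *)
exists (3 * y), x, (z - w), (z + 2 * w); rewrite nE r0 qE /f_abc; ring.
Qed.

Lemma universal_161 : universal 1 6 1.
Proof.
move=> n n0; have [q [r [nE r3]]] := @Z_residue n 3 ltac:(lia).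
have [r0|r0] := Z.eq_dec r 0; last first.
  by rewrite -(Z.add_0_r n) -(Z.mul_0_r 6); apply: (@represents_1b1 6 0 n q); lia.
have [x [y [z [w qE]]]] := @universal_2b1_odd 3 (or_introl (Logic.eq_refl _)) q ltac:(lia).
exists (3 * y), x, (z - w), (z + 2 * w); rewrite nE r0 qE /f_abc; ring.
Qed.

Lemma universal_122 : universal 1 2 2.
Proof.
move=> n n0; have [q [r [nE r2]]] := Z_residue n Z.lt_0_2.
have [r0|r0] := Z.eq_dec r 0.
  have [x [y [z [w qE]]]] := @universal_1b1_prime_to_3 2 (or_intror (or_introl (Logic.eq_refl _))) q ltac:(lia).
  by exists (2 * y), x, z, w; rewrite nE r0 qE /f_abc; ring.
have [nb|nb] := Z_lt_le_dec n 10.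
  by apply: (@represents_below _ _ _ _ 10) => //; vm_compute.
have [k [s [qE s3]]] := @Z_residue q 3 ltac:(lia).
have [t [x [z [w E]]]] : exists t x z w, n = t ^ 2 + 2 * (x ^ 2 + eis z w).
  have [s0|s0] := Z.eq_dec s 0.
    have [||x [z [w E]]] := @sqr_add_norm (q - 4) (k - 2); [lia | lia |].
    by exists 3, x, z, w; rewrite -E; lia.
  have [||x [z [w E]]] := @sqr_add_norm q k; [lia | lia |].
  by exists 1, x, z, w; rewrite -E; lia.
by exists t, x, z, w; rewrite E /f_abc /eis; ring.
Qed.

Lemma universal_of_mod4 a b c :
    (forall q r, 0 <= q -> 0 < r < 4 -> represents a b c (4 * q + r)) -> universal a b c.
Proof.
move=> h; apply: Zlt_0_ind => n IH n0; have [q [r [nE r4]]] := @Z_residue n 4 ltac:(lia).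
have [r0|r0] := Z.eq_dec r 0; last by rewrite nE; apply: h; lia.
have [->|n1] := Z.eq_dec n 0; first exact: represents_zero.
by rewrite nE r0 Z.add_0_r; apply/represents_mul4/IH; lia.
Qed.

Lemma universal_1b2 b : b = 1 \/ b = 3 \/ b = 4 \/ b = 5 -> universal 1 b 2.
Proof.
move=> bE; apply: universal_of_mod4 => q' r' q0 r0; set n := 4 * q' + r'.
have n0 : 0 <= n by rewrite /n; lia.
(* The largest b y^2 subtracted below is 5 * 2^2 = 20. *)
have [nb|nb] := Z_lt_le_dec n 21.
  by apply: (@represents_below _ _ _ _ 21) => //; case: bE => [|[|[|]]] ->; vm_compute.
have [q [r [nE r8]]] := @Z_residue n 8 ltac:(lia).
have [y [k [yn kE]]] : exists y k, 0 < n - b * y ^ 2 /\ (n - b * y ^ 2 = 8 * k + 1 \/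
    n - b * y ^ 2 = 8 * k + 7 \/ n - b * y ^ 2 = 4 * k + 2).
  have rE : r = 1 \/ r = 2 \/ r = 3 \/ r = 5 \/ r = 6 \/ r = 7 by rewrite /n in nE; lia.
  case: rE => [|[|[|[|[|]]]]] rE.
  - by exists 0, q; lia.
  - by exists 0, (2 * q); lia.
  - case: bE => [|[|[|]]] bE.
    + by exists 1, (2 * q); lia.
    + by exists 2, (q - 2); lia.
    + by exists 1, (q - 1); lia.
    + by exists 1, (2 * q - 1); lia.
  - case: bE => [|[|[|]]] bE.
    + by exists 2, q; lia.
    + by exists 1, (2 * q); lia.
    + by exists 1, q; lia.
    + by exists 2, (q - 2); lia.
  - by exists 0, (2 * q + 1); lia.
  - by exists 0, q; lia.
have -> : n = (n - b * y ^ 2) + b * y ^ 2 by ring.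
exact: represents_1b2 yn kE.
Qed.

Lemma universal_2b1_even b : universal 1 b 2 -> universal 2 (2 * b) 1.
Proof.
move=> h n n0; have [q [r [nE r2]]] := Z_residue n Z.lt_0_2.
have [r0|r0] := Z.eq_dec r 0; last first.
  by rewrite -(Z.add_0_r n) -(Z.mul_0_r (2 * b)); apply: (@represents_2b1 (2 * b) 0 n q); lia.
have [x [y [z [w qE]]]] := h q ltac:(lia).
by exists x, y, (2 * z), (2 * w); rewrite nE r0 qE /f_abc; ring.
Qed.

Lemma universal_124 : universal 1 2 4.
Proof.
move=> n n0; have [q [r [nE r2]]] := Z_residue n Z.lt_0_2.
have [r0|r0] := Z.eq_dec r 0.
  have [x [y [z [w qE]]]] := @universal_122 q ltac:(lia).
  by exists (2 * y), x, z, w; rewrite nE r0 qE /f_abc; ring.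
have [nb|nb] := Z_lt_le_dec n 50.
  by apply: (@represents_below _ _ _ _ 50) => //; vm_compute.
have [j [s [qE s16]]] := @Z_residue q 16 ltac:(lia).
(* Then m = x^2 + 2N gives n = t^2 + 2(ex)^2 + 4 e^2 N. Odd t changes (n - t^2)/2 only by multiples
   of 4, so for q = 0 mod 4 the factor 4 must be taken out with e = 2. The threshold 50 comes from t
   = 7. *)
have [t [e [m [nE' [m0 [k kE]]]]]] : exists t e m, n = t ^ 2 + 2 * e ^ 2 * m /\ 0 < m /\
    exists k, m = 8 * k + 1 \/ m = 8 * k + 7 \/ m = 4 * k + 2.
  have [odd_s|[s0|[s4|[s8|[s12|even_s]]]]] :
    (s = 1 \/ s = 3 \/ s = 5 \/ s = 7 \/ s = 9 \/ s = 11 \/ s = 13 \/ s = 15) \/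
    s = 0 \/ s = 4 \/ s = 8 \/ s = 12 \/ (s = 2 \/ s = 6 \/ s = 10 \/ s = 14) by lia.
  - case: odd_s => [|[|[|[|[|[|[|]]]]]]] sE.
    + by exists 1, 1, q; split; [lia | split; [lia | exists (2 * j); lia]].
    + by exists 3, 1, (q - 4); split; [lia | split; [lia | exists (2 * j - 1); lia]].
    + by exists 3, 1, (q - 4); split; [lia | split; [lia | exists (2 * j); lia]].
    + by exists 1, 1, q; split; [lia | split; [lia | exists (2 * j); lia]].
    + by exists 1, 1, q; split; [lia | split; [lia | exists (2 * j + 1); lia]].
    + by exists 3, 1, (q - 4); split; [lia | split; [lia | exists (2 * j); lia]].
    + by exists 3, 1, (q - 4); split; [lia | split; [lia | exists (2 * j + 1); lia]].
    + by exists 1, 1, q; split; [lia | split; [lia | exists (2 * j + 1); lia]].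
  - by exists 7, 2, (4 * j - 6); split; [lia | split; [lia | exists (j - 2); lia]].
  - by exists 5, 2, (4 * j - 2); split; [lia | split; [lia | exists (j - 1); lia]].
  - by exists 1, 2, (4 * j + 2); split; [lia | split; [lia | exists j; lia]].
  - by exists 3, 2, (4 * j + 2); split; [lia | split; [lia | exists j; lia]].
  by exists 1, 1, q; split; [lia | split; [lia | case: even_s => [|[|[|]]] sE;
    [exists (4 * j) | exists (4 * j + 1) | exists (4 * j + 2) | exists (4 * j + 3)]; lia]].
have [x [y [z [w mE]]]] := represents_1b2 0 0 m0 kE.
exists t, (e * x), (e * z), (e * w); rewrite nE'.
have -> : m = x ^ 2 + 2 * eis z w by move: mE; rewrite /f_abc /eis; lia.
by rewrite /f_abc /eis; ring.
Qed.

Lemma universal_123 : universal 1 2 3.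
Proof.
move=> n n0; have [q [r [nE r3]]] := @Z_residue n 3 ltac:(lia).
have [r0|[r1|r2]] : r = 0 \/ r = 1 \/ r = 2 by lia.
- have [x [y [z [w qE]]]] := @universal_1b1_prime_to_3 2 (or_intror (or_introl (Logic.eq_refl _))) q ltac:(lia).
  by exists (x + 2 * y), (x - y), z, w; rewrite nE r0 qE /f_abc; ring.
- have [||X [z [w E]]] := @sqr_add_norm n q; [lia | lia |].
  have [a [b NE]] := eis_diagonal z w; rewrite NE in E.
  (* In n = X^2 + a^2 + 3b^2 = 1 mod 3 one of X, a is a multiple of 3, and c^2 + 3v^2 = N(c - v,
     2v). *)
  suff [u [v [c nE']]] : exists u v c, n = u ^ 2 + 3 * (3 * v ^ 2 + c ^ 2).
    by exists u, 0, (c - v), (2 * v); rewrite nE' /f_abc; ring.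
  have [p [e [XE e3]]] := @Z_residue X 3 ltac:(lia).
  have [p' [e' [aE e3']]] := @Z_residue a 3 ltac:(lia).
  have [e0|e0] : e = 0 \/ e' = 0.
    rewrite XE aE nE r1 in E; clear -E e3 e3'.
    have e'E : e' = 0 \/ e' = 1 \/ e' = 2 by lia.
    have eE : e = 0 \/ e = 1 \/ e = 2 by lia.
    by case: eE E => [|[|]] -> E; case: e'E E => [|[|]] -> E; lia.
  + by exists a, p, b; rewrite E XE e0; ring.
  + by exists X, p', b; rewrite E aE e0; ring.
have [nb|nb] := Z_lt_le_dec n 129.
  by apply: (@represents_below _ _ _ _ 129) => //; vm_compute.
have [j [s [nE' s27]]] := @Z_residue n 27 ltac:(lia).
(* Since 9N(z, w) = 3N(z - w, z + 2w), it suffices that m = x^2 + N. The values of y make n - 2y^2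
   equal to 9 or 18 modulo 27; the largest, 8, sets the threshold 129. *)
have [y [m [k [yE [m0 kE]]]]] : exists y m k, n = 2 * y ^ 2 + 9 * m /\ 0 < m /\
    (m = 3 * k + 1 \/ m = 3 * k + 2).
  have sE : s = 2 \/ s = 5 \/ s = 8 \/ s = 11 \/ s = 14 \/ s = 17 \/ s = 20 \/ s = 23 \/ s = 26 by lia.
  case: sE => [|[|[|[|[|[|[|[|]]]]]]]] sE.
  - by exists 8, (3 * j - 14), (j - 5); lia.
  - by exists 5, (3 * j - 5), (j - 2); lia.
  - by exists 7, (3 * j - 10), (j - 4); lia.
  - by exists 1, (3 * j + 1), j; lia.
  - by exists 4, (3 * j - 2), (j - 1); lia.
  - by exists 2, (3 * j + 1), j; lia.
  - by exists 1, (3 * j + 2), j; lia.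
  - by exists 4, (3 * j - 1), (j - 1); lia.
  - by exists 2, (3 * j + 2), j; lia.
have [x [z [w mE]]] := sqr_add_norm m0 kE.
exists (3 * x), y, (z - w), (z + 2 * w); rewrite yE mE /f_abc /eis; ring.
Qed.

Lemma universal_of_triple a b c : universal_triple a b c -> universal a b c.
Proof.
case=> [[-> [-> b16]]|[[-> [-> b2]]|[[-> [-> b15]]|[[-> [-> ->]]|[-> [-> ->]]]]]].
- have [h|[->|->]] : (b = 1 \/ b = 2 \/ b = 4 \/ b = 5) \/ b = 3 \/ b = 6 by lia.
  + exact: universal_1b1_prime_to_3.
  + exact: universal_131.
  + exact: universal_161.
- have [h|[k [-> kE]]] : (b = 3 \/ b = 5 \/ b = 7 \/ b = 9) \/
      exists k, b = 2 * k /\ (k = 2 \/ (k = 1 \/ k = 3 \/ k = 4 \/ k = 5)).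
  + have [q [r [bE r2]]] := Z_residue b Z.lt_0_2.
    have r01 : r = 0 \/ r = 1 by lia.
    by case: r01 => r0; [right; exists q; lia | left; lia].
  + exact: universal_2b1_odd.
  + apply: universal_2b1_even; case: kE => [->|]; [exact: universal_122 | exact: universal_1b2].
- have [->|h] : b = 2 \/ (b = 1 \/ b = 3 \/ b = 4 \/ b = 5) by lia.
  + exact: universal_122.
  + exact: universal_1b2.
- exact: universal_123.
- exact: universal_124.
Qed.

(** * Necessity of the list *)

Lemma small_square (t : Z) : t ^ 2 = 0 \/ t ^ 2 = 1 \/ t ^ 2 = 4 \/ t ^ 2 = 9 \/ 16 <= t ^ 2.
Proof.
have [h|h] : -4 < t < 4 \/ 16 <= t ^ 2 by nia.
  have : t = -3 \/ t = -2 \/ t = -1 \/ t = 0 \/ t = 1 \/ t = 2 \/ t = 3 by lia.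
  by case=> [|[|[|[|[|[|]]]]]] ->; lia.
by auto.
Qed.

Lemma small_norm (z w : Z) : eis z w = 0 \/ eis z w = 1 \/ eis z w = 3 \/ eis z w = 4 \/ eis z w = 7 \/
  eis z w = 9 \/ 12 <= eis z w.
Proof.
have [h|h] : (-4 < w < 4 /\ -4 < z < 4) \/ 12 <= eis z w.
  have h1 : 4 * eis z w = (2 * z + w) ^ 2 + 3 * w ^ 2 by rewrite /eis; ring.
  have h2 : 4 * eis z w = (2 * w + z) ^ 2 + 3 * z ^ 2 by rewrite /eis; ring.
  have := small_square z; have := small_square w; nia.
have wE : w = -3 \/ w = -2 \/ w = -1 \/ w = 0 \/ w = 1 \/ w = 2 \/ w = 3 by lia.
have zE : z = -3 \/ z = -2 \/ z = -1 \/ z = 0 \/ z = 1 \/ z = 2 \/ z = 3 by lia.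
by case: wE => [|[|[|[|[|[|]]]]]] ->; case: zE => [|[|[|[|[|[|]]]]]] ->; rewrite /eis; lia.
by auto 10.
Qed.

Lemma represents_small a b c n : 0 < a -> 0 < b -> 0 < c -> n <= 10 -> represents a b c n ->
  exists x y v, n = a * x + b * y + c * v /\
    (x = 0 \/ x = 1 \/ x = 4 \/ x = 9) /\ (y = 0 \/ y = 1 \/ y = 4 \/ y = 9) /\
    (v = 0 \/ v = 1 \/ v = 3 \/ v = 4 \/ v = 7 \/ v = 9).
Proof.
move=> a0 b0 c0 n10 [x [y [z [w nE]]]]; exists (x ^ 2), (y ^ 2), (eis z w); split; first exact: nE.
rewrite /f_abc -/(eis z w) in nE.
have := small_square x; have := small_square y; have := small_norm z w.
move: (x ^ 2) (y ^ 2) (eis z w) nE => {x y z w} x y v nE hv hy hx.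
have [x0 [y0 v0]] : 0 <= x /\ 0 <= y /\ 0 <= v by lia.
have [ax [by' cv]] : x <= a * x /\ y <= b * y /\ v <= c * v by nia.
lia.
Qed.

Ltac by_values R :=
  let x := fresh "x" in let y := fresh "y" in let v := fresh "v" in let E := fresh "E" in
  let hx := fresh "hx" in let hy := fresh "hy" in let hv := fresh "hv" in
  case: R => x [y [v [E [hx [hy hv]]]]];
  case: hx => [|[|[|]]] hx; case: hy => [|[|[|]]] hy; case: hv => [|[|[|[|[|]]]]] hv;
  rewrite hx hy hv in E; lia.

(** Escalation: a value missed by part of the form bounds the next coefficient. N misses 2, x^2 + N
    misses 6, 2x^2 + N misses 10 and x^2 + 2N misses 5. For a = 1 and c >= 3, the value 2 forces b
    <= 2; then x^2 + y^2 misses 3 and x^2 + 2y^2 misses 5, which bound c. The survivors (1, 1, 3)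
    and (1, 2, 5) miss 6 and 10. *)
Lemma triple_of_represents (a b c : Z) : 0 < a -> 0 < b -> 0 < c -> a <= b ->
  (forall n : Z, In n (1 :: 2 :: 3 :: 5 :: 6 :: 10 :: nil) -> represents a b c n) ->
  universal_triple a b c.
Proof.
move=> a0 b0 c0 ab h.
have R n : In n (1 :: 2 :: 3 :: 5 :: 6 :: 10 :: nil) -> n <= 10 ->
  exists x y v, n = a * x + b * y + c * v /\
    (x = 0 \/ x = 1 \/ x = 4 \/ x = 9) /\ (y = 0 \/ y = 1 \/ y = 4 \/ y = 9) /\
    (v = 0 \/ v = 1 \/ v = 3 \/ v = 4 \/ v = 7 \/ v = 9).
  by move=> hn n10; apply: represents_small => //; apply: h.
have R1 := R 1 ltac:(simpl; tauto) ltac:(lia); have R2 := R 2 ltac:(simpl; tauto) ltac:(lia).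
have R3 := R 3 ltac:(simpl; tauto) ltac:(lia); have R5 := R 5 ltac:(simpl; tauto) ltac:(lia).
have R6 := R 6 ltac:(simpl; tauto) ltac:(lia); have R10 := R 10 ltac:(simpl; tauto) ltac:(lia).
clear h R; rewrite /universal_triple.
have ac : a = 1 \/ c = 1 by clear -R1 a0 b0 c0 ab; by_values R1.
have [c1|c2] := Z.eq_dec c 1.
  have a2 : a <= 2 by clear -R2 a0 b0 c1 ab; by_values R2.
  have [a1|a1] := Z.eq_dec a 1.
    have b6 : b <= 6 by clear -R6 a1 b0 c1; by_values R6.
    by lia.
  have a2' : a = 2 by lia.
  have b10 : b <= 10 by clear -R10 a2' b0 c1; by_values R10.
  by lia.
have {ac ab} a1 : a = 1 by lia.
have [c2'|c3] := Z.eq_dec c 2.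
  have b5 : b <= 5 by clear -R5 a1 b0 c2'; by_values R5.
  by lia.
have {c2 c3} c3 : 3 <= c by lia.
have b2 : b <= 2 by clear -R2 a1 b0 c3; by_values R2.
have [b1|b1] := Z.eq_dec b 1.
  have c3' : c = 3 by clear -R3 a1 b1 c3; by_values R3.
  by exfalso; clear -R6 a1 b1 c3'; by_values R6.
have {b1 b2} b2 : b = 2 by lia.
have c5 : c <= 5 by clear -R5 a1 b2 c3; by_values R5.
have c5' : c <> 5 by move=> c5'; clear -R10 a1 b2 c5'; by_values R10.
by lia.
Qed.

Unset Implicit Arguments.

Theorem theorem1p1 : forall a b c : Z, 0 < a -> 0 < b -> 0 < c -> a <= b ->
  (universal a b c <-> universal_triple a b c) /\
  ((forall n : Z, In n (1 :: 2 :: 3 :: 5 :: 6 :: 10 :: nil) -> represents a b c n) ->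
    universal a b c).
Proof.
move=> a b c a0 b0 c0 ab; have escalation := triple_of_represents a0 b0 c0 ab.
split; last by move=> h; apply/universal_of_triple/escalation.
split; last exact: universal_of_triple.
by move=> u; apply: escalation => n hn; apply: u; move: hn => /=; lia.
Qed.
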